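(* (1) For every vertex $v$ of eligible tenacity, the set $B(v)$ is a singleton; in particular $\mathrm{base}(v)$ is defined for every vertex of eligible tenacity and the blossoms $\mathcal{B}_{b,t}$ are defined for every eligible $t$. Now let $t$ be an eligible tenacity and $v$ a vertex with $\mathrm{t}(v)=t$. Then: (2) every $\mathrm{maxlevel}(v)$ path contains exactly one bridge of tenacity $t$; (3) the blossoms of tenacity at most $t$ form a laminar family (any two are disjoint or one contains the other); (4) if $\mathrm{base}(v)=b$ and $u\in\mathcal{B}_{b,t}$, then every $\mathrm{evenlevel}(u)$ (respectively $\mathrm{oddlevel}(u)$) path consists of an $\mathrm{evenlevel}(b)$ path concatenated with an $\mathrm{evenlevel}(b;u)$ (respectively $\mathrm{oddlevel}(b;u)$) path; moreover every $\mathrm{evenlevel}(b;u)$ and every $\mathrm{oddlevel}(b;u)$ path lies in $\mathcal{B}_{b,t}\cup\{b\}$, and every edge on every such path has tenacity at most $t$; (5) if $\mathrm{base}(v)=b$, $p$ is an $\mathrm{evenlevel}(v)$ or $\mathrm{oddlevel}(v)$ path, and $u$ lies on $p(b\text{ to }v]$, then $\mathrm{base}(u)$ lies on $p[b\text{ to }v]$. Additionally, for every vertex $v$ of tenacity $l_m$, every $\mathrm{maxlevel}(v)$ path contains exactly one bridge of tenacity $l_m$.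
   Context: $G=(V,E)$ is a finite undirected graph and $M$ a matching; edges in $M$ are matched, others unmatched; a vertex is unmatched if no matched edge is incident to it. An alternating path is a simple path alternating between matched and unmatched edges; $l_m$ is the minimum length of an alternating path joining two distinct unmatched vertices ($\infty$ if none). $\mathrm{evenlevel}(v)$ ($\mathrm{oddlevel}(v)$) is the length of a minimum even (odd) length alternating path from some unmatched vertex to $v$ ($\infty$ if none); such a path is an $\mathrm{evenlevel}(v)$ ($\mathrm{oddlevel}(v)$) path. $\mathrm{minlevel}(v)$ and $\mathrm{maxlevel}(v)$ are the smaller and larger of these; a $\mathrm{minlevel}(v)$ ($\mathrm{maxlevel}(v)$) path is an evenlevel$(v)$ or oddlevel$(v)$ path of that length. A vertex with finite minlevel is outer if $\mathrm{evenlevel}(v)<\mathrm{oddlevel}(v)$, inner otherwise. Tenacity: $\mathrm{t}(v)=\mathrm{evenlevel}(v)+\mathrm{oddlevel}(v)$; an unmatched edge has $\mathrm{t}(u,v)=\mathrm{evenlevel}(u)+\mathrm{evenlevel}(v)+1$, a matched edge $\mathrm{t}(u,v)=\mathrm{oddlevel}(u)+\mathrm{oddlevel}(v)+1$. $t_m$ is the minimum tenacity of a vertex; an odd $t$ with $t_m\le t<l_m$ is an eligible tenacity. The last edge of any $\mathrm{minlevel}(v)$ path is a prop; an edge that is not a prop is a bridge. For a path $p$ starting at unmatched $f$: a vertex is higher than another if farther from $f$ along $p$; $p[x\text{ to }y]$ is the subpath from $x$ to $y$, and $p(x\text{ to }y]$ the same subpath without $x$. For $v$ of eligible tenacity $t$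 and $p$ an evenlevel$(v)$ or oddlevel$(v)$ path, $F(p,v)$ is the highest vertex on $p$ of tenacity $>t$; $B(v)=\{F(p,v)\}$ over all such $p$; when $B(v)$ is a singleton its element is $\mathrm{base}(v)$. For vertices $b,u$, an $\mathrm{evenlevel}(b;u)$ ($\mathrm{oddlevel}(b;u)$) path is a minimum length even (odd) length alternating path from $b$ to $u$ whose first edge is unmatched. Blossoms: for an outer vertex $b$ and odd $t$ with $\mathrm{t}(b)>t$ (and bases defined for all vertices of tenacity $\le t$), $\mathcal{B}_{b,1}=\emptyset$, $S_{b,t}=\{v:\mathrm{t}(v)=t,\ \mathrm{base}(v)=b\}$, and $\mathcal{B}_{b,t}=S_{b,t}\cup\bigcup_{w\in S_{b,t}\cup\{b\},\ w\text{ outer}}\mathcal{B}_{w,t-2}$; this is the blossom of tenacity $t$ and base $b$. *)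

(* Defs.v *)
From HB Require Import structures.
From mathcomp Require Import all_boot.

Set Implicit Arguments.
Unset Strict Implicit.
Unset Printing Implicit Defensive.

(* Extended natural numbers: [None] is infinity. *)
Definition enat : eqType := option nat.
Definition ele (a b : enat) : bool :=
  match a, b with
  | _, None => true
  | None, Some _ => false
  | Some m, Some n => m <= n
  end.
Definition elt (a b : enat) : bool := ~~ ele b a.
Definition eadd (a b : enat) : enat :=
  match a, b with Some m, Some n => Some (m + n) | _, _ => None end.
Definition emin (a b : enat) : enat := if ele a b then a else b.
Definition emax (a b : enat) : enat := if ele a b then b else a.

Definition graph (V : finType) (e : rel V) : Prop :=
  symmetric e /\ irreflexive e.

Definition matching (V : finType) (e M : rel V) : Prop :=
  [/\ symmetric M, subrel M e & forall x y z, M x y -> M x z -> y = z].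

Section AlternatingPaths.
Context (V : finType) (e M : rel V).

Definition unmatched (v : V) : bool := [forall u, ~~ M v u].

(* A path is the sequence of its vertices (starting point included); an edge
   of it is recorded as the ordered pair of its ends in order of traversal.
   Simple paths never traverse an edge twice, nor in both directions. *)
Definition plen (p : seq V) : nat := (size p).-1.
Definition path_edges (p : seq V) : seq (V * V) := zip p (behead p).
Definition edge_types (p : seq V) : bitseq :=
  [seq M xy.1 xy.2 | xy <- path_edges p].
Definition from_to (x y : V) (p : seq V) : bool :=
  if p is z :: s then (z == x) && (last z s == y) else false.

Definition alternating (p : seq V) : bool :=
  [&& uniq p, sorted e p & sorted (fun a b => a != b) (edge_types p)].

(* Minimum length of a path satisfying [P], infinity if there is none. Ranging
   over sequences of size at most [#|V|] loses nothing for simple paths. *)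
Definition min_len (P : pred (seq V)) : enat :=
  \big[emin/None]_(p : #|V|.-bseq V | P p) Some (plen p).
Definition min_len_path (P : pred (seq V)) (p : seq V) : bool :=
  P p && (Some (plen p) == min_len P).

Definition augmenting (p : seq V) : bool :=
  alternating p &&
  [exists f, exists g, [&& f != g, unmatched f, unmatched g & from_to f g p]].
Definition l_m : enat := min_len augmenting.

(* The boolean [o] is the parity of the length: [true] for odd. *)
Definition reaches (o : bool) (v : V) (p : seq V) : bool :=
  [&& alternating p, odd (plen p) == o
    & [exists f, unmatched f && from_to f v p]].
Definition level (o : bool) (v : V) : enat := min_len (reaches o v).
Definition level_path (o : bool) (v : V) : pred (seq V) :=
  min_len_path (reaches o v).
Definition evenlevel := level false.
Definition oddlevel := level true.
Definition evenlevel_path := level_path false.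
Definition oddlevel_path := level_path true.

Definition minlevel (v : V) : enat := emin (evenlevel v) (oddlevel v).
Definition maxlevel (v : V) : enat := emax (evenlevel v) (oddlevel v).
Definition evenodd_path (v : V) (p : seq V) : bool :=
  evenlevel_path v p || oddlevel_path v p.
Definition minlevel_path (v : V) (p : seq V) : bool :=
  evenodd_path v p && (Some (plen p) == minlevel v).
Definition maxlevel_path (v : V) (p : seq V) : bool :=
  evenodd_path v p && (Some (plen p) == maxlevel v).

Definition outer (v : V) : bool := elt (evenlevel v) (oddlevel v).

Definition tenacity (v : V) : enat := eadd (evenlevel v) (oddlevel v).
Definition edge_tenacity (x y : V) : enat :=
  if M x y then eadd (eadd (oddlevel x) (oddlevel y)) (Some 1)
  else eadd (eadd (evenlevel x) (evenlevel y)) (Some 1).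

Definition t_m : enat := \big[emin/None]_(v : V) tenacity v.
Definition eligible (t : nat) : bool :=
  [&& odd t, ele t_m (Some t) & elt (Some t) l_m].

Definition last_edge (x y : V) (p : seq V) : Prop :=
  exists q, p = rcons (rcons q x) y.
Definition prop_edge (x y : V) : Prop :=
  exists p, (minlevel_path y p /\ last_edge x y p)
         \/ (minlevel_path x p /\ last_edge y x p).
Definition bridge (x y : V) : Prop := e x y /\ ~ prop_edge x y.

Definition unique_bridge (t : enat) (p : seq V) : Prop :=
  exists! xy : V * V,
    [/\ xy \in path_edges p, bridge xy.1 xy.2 & edge_tenacity xy.1 xy.2 = t].

(* [None] when no vertex of [p] has tenacity larger than that of [v]. *)
Definition F (p : seq V) (v : V) : option V :=
  ohead [seq x <- rev p | elt (tenacity v) (tenacity x)].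
Definition B (v : V) : {set option V} :=
  [set F p v | p : #|V|.-bseq V & evenodd_path v p].
Definition base (v : V) : option V := [pick b | B v == [set Some b]].

(* [blossom b t] is meant for odd [t], outer [b] with [tenacity b > t], and
   [blossoms_defined t]. [blossom_rec k b] is the blossom of base [b] and
   tenacity [2 * k + 1]. *)
Definition blossoms_defined (t : nat) : Prop :=
  forall v, ele (tenacity v) (Some t) -> exists b, base v = Some b.
Definition S_ (b : V) (t : nat) : {set V} :=
  [set v | (tenacity v == Some t) && (base v == Some b)].
Fixpoint blossom_rec (k : nat) (b : V) : {set V} :=
  if k is k'.+1 then
    S_ b k.*2.+1 :|:
    \bigcup_(w in b |: S_ b k.*2.+1 | outer w) blossom_rec k' w
  else set0.
Definition blossom (b : V) (t : nat) : {set V} := blossom_rec t./2 b.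
Definition is_blossom (t : nat) (X : {set V}) : Prop :=
  exists b, [/\ odd t, outer b, elt (Some t) (tenacity b) & X = blossom b t].

Definition reaches_from (o : bool) (b u : V) (p : seq V) : bool :=
  [&& alternating p, odd (plen p) == o, from_to b u p
    & ~~ head false (edge_types p)].
Definition level_path_from (o : bool) (b u : V) : pred (seq V) :=
  min_len_path (reaches_from o b u).
Definition evenlevel_path_from := level_path_from false.
Definition oddlevel_path_from := level_path_from true.

Definition concat_path (q r : seq V) : seq V := q ++ behead r.

(* [p[b to v]] and [p(b to v]] for a path [p] ending at [v]. *)
Definition subpath_cc (p : seq V) (b : V) : seq V := drop (index b p) p.
Definition subpath_oc (p : seq V) (b : V) : seq V := behead (subpath_cc p b).

End AlternatingPaths.

(* Main.v *)
(** The proof is primal-dual.  For each [s], contract all edges of tenacity less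
    than [2 * s]; call [b s v] the base of the class of [v].  The levels together
    with these bases yield a dual solution of Edmonds' matching LP (the state of
    his algorithm after [s] steps), hence a lower bound on the length of every
    alternating path starting at a base.  Paths attaining the bound, in
    particular all evenlevel and oddlevel paths, obey complementary slackness:
    an unmatched edge leaving a class has the base behind it, and an unmatched
    edge entering a class has the base still ahead or not on the path at all.
    The claims on bases, blossoms and bridges are read off from this.

    The bases are constructed by induction on [s].  If an edge of tenacity
    [2 * s + 1 < l_m] joins two classes, one follows minlevel paths from both of
    its ends towards the unmatched vertices, always advancing on the side that
    is farther away, until the two walks meet in a class (otherwise they form an
    augmenting path that is too short); everything on the closed walk is then
    absorbed by that class. *)

Require Import Defs.
From HB Require Import structures.
From mathcomp Require Import all_boot.
From mathcomp Require Import zify.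

Set Implicit Arguments.
Unset Strict Implicit.
Unset Printing Implicit Defensive.

(** The dual sums to at least [2T] over the ends and classes of an unmatched edge and to exactly
    [2T + 2] for a matched one. Along an alternating path these sums telescope, the gap of 2 paying
    for two consecutive edges; what remains are class terms that record which bases lie on the path,
    and simplicity of the path gives them the right sign.

    The bound at stage [T] is exact for all vertices of tenacity up to [2T + 1], one step beyond
    what is contracted. Hence the bridges of tenacity [2T + 1] can be studied at stage [T], even for
    [2T + 1 = l_m], where stage [T + 1] is not constructed.

    Between stages [T] and [T + 1] there is no dual for the partly built classes. Minimality of the
    new paths comes from counting instead: the closed walk reaches each of its vertices in both
    parities with total length [2T + 1], and a vertex not contracted at stage [T] cannot have
    smaller tenacity. *)

Ltac lia_nat :=
  repeat match goal with
  | H : ?A |- _ =>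
      lazymatch type of A with
      | Prop =>
          lazymatch A with
          | @eq bool (odd _) _ => fail
          | @eq ?T _ _ => tryif unify T nat then fail else clear H
          | is_true (leq _ _) => fail
          | is_true (odd _) => fail
          | is_true (~~ odd _) => fail
          | _ => clear H
          end
      end
  end; lia.

(** * Minima, alternating walks and levels *)

Lemma big_eminP (I : eqType) (r : seq I) (P : pred I) (F : I -> nat) :
  match \big[emin/None]_(i <- r | P i) Some (F i) with
  | Some n => (exists2 i, (i \in r) && P i & F i = n) /\
              forall i, i \in r -> P i -> n <= F i
  | None => forall i, i \in r -> ~~ P i
  end.
Proof.
elim: r => [|i r IH]; first by rewrite big_nil.
rewrite big_cons; case: ifP => Pi; last first.
  case: (\big[_/_]_(_ <- _ | _) _) IH => [n [[j /andP[rj Pj] <-] nmin]|nP].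
    split=> [|k]; first by exists j; rewrite // inE rj orbT.
    by rewrite inE => /predU1P[->|]; [rewrite Pi | apply: nmin].
  by move=> k; rewrite inE => /predU1P[->|]; [rewrite Pi | apply: nP].
case: (\big[_/_]_(_ <- _ | _) _) IH => [n [[j /andP[rj Pj] Fj] nmin]|nP].
  rewrite /emin /=; case: leqP => le_n.
    split=> [|k]; first by exists i; rewrite // mem_head.
    rewrite inE => /predU1P[->//|rk Pk].
    exact: leq_trans le_n (nmin k rk Pk).
  split=> [|k]; first by exists j; rewrite // inE rj orbT.
  by rewrite inE => /predU1P[->|]; [move=> _; apply: ltnW | apply: nmin].
rewrite /emin /=; split=> [|k]; first by exists i; rewrite // mem_head.
by rewrite inE => /predU1P[->//|rk]; rewrite (negPf (nP k rk)).
Qed.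

Section Matching.
Context (V : finType) (e M : rel V) (He : graph e) (HM : matching e M).

Lemma min_lenP (P : pred (seq V)) : (forall p, P p -> uniq p) ->
  match min_len P with
  | Some n => (exists2 p, P p & plen p = n) /\ forall p, P p -> n <= plen p
  | None => forall p, ~~ P p
  end.
Proof.
move=> Pu; rewrite /min_len.
have sz p : P p -> size p <= #|V| by move/Pu => up; rewrite -(card_uniqP up) max_card.
have := big_eminP (index_enum _) (fun p : #|V|.-bseq V => P p) (fun p => plen p).
case: (\big[_/_]_(_ <- _ | _) _) => [n [[p /andP[_ Pp] <-] nmin]|nP].
  split=> [|q Pq]; first by exists p.
  exact: (nmin (Bseq (sz q Pq)) (mem_index_enum _)).
move=> q; apply/negP => Pq.
by have := nP (Bseq (sz q Pq)) (mem_index_enum _); rewrite Pq.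
Qed.

Lemma splitPlast (x y : V) (s : seq V) : y \in x :: s ->
  exists s1 s2 : seq V, s = s1 ++ s2 /\ last x s1 = y.
Proof. by case/splitPl => s1 s2 <-; exists s1, s2. Qed.

(** The type of the next edge is carried along and the start is kept apart from the tail, so that
    walks can be cut and glued without inspecting the edges at the cut. [apath] adds simplicity and
    an unmatched first edge; the latter is automatic at an unmatched vertex. *)
Fixpoint alts (o : bool) (x : V) (s : seq V) : bool :=
  if s is y :: s' then [&& e x y, M x y == o & alts (~~ o) y s'] else true.

Definition apath (x : V) (s : seq V) : bool := alts false x s && uniq (x :: s).

Lemma alts_cat o x s1 s2 :
  alts o x (s1 ++ s2) = alts o x s1 && alts (o (+) odd (size s1)) (last x s1) s2.
Proof.
elim: s1 o x => [|y s1 IH] o x /=; first by rewrite addbF.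
by rewrite IH -!andbA; congr [&& _, _, _ & alts _ _ _]; case: o; case: odd.
Qed.

Lemma alts_rcons o x s y :
  alts o x (rcons s y) =
  [&& alts o x s, e (last x s) y & M (last x s) y == o (+) odd (size s)].
Proof. by rewrite -cats1 alts_cat /= andbT. Qed.

Lemma edge_sym x y : e x y = e y x. Proof. by case: He => /(_ x y). Qed.
Lemma edge_irr x : e x x = false. Proof. by case: He => _ /(_ x). Qed.
Lemma mate_sym x y : M x y = M y x. Proof. by case: HM => /(_ x y). Qed.
Lemma matchingW x y : M x y -> e x y. Proof. by case: HM => _ /(_ x y). Qed.
Lemma mate_uniq x y z : M x y -> M x z -> y = z.
Proof. by case: HM => _ _; apply. Qed.
Lemma mate_uniql x y z : M x z -> M y z -> x = y.
Proof. by rewrite !(mate_sym _ z); apply: mate_uniq. Qed.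

Lemma alts_rev o x s :
  alts o x s ->
  alts (o (+) ~~ odd (size s)) (last x s) (rev (belast x s)).
Proof.
elim: s o x => [|y s IH] o x //= /and3P[exy /eqP Mxy /IH].
rewrite rev_cons -cats1 alts_cat /= size_rev size_belast.
rewrite (_ : o (+) ~~ ~~ odd (size s) = ~~ o (+) ~~ odd (size s)); last first.
  by case: o {Mxy}; case: odd.
move=> ->; rewrite /= andbT.
have -> : last (last y s) (rev (belast y s)) = y.
  by case: s {IH} => //= z s; rewrite rev_cons last_rcons.
rewrite edge_sym exy mate_sym Mxy /=; by case: o {Mxy}; case: odd.
Qed.

Lemma altsE o x s :
  alts o x s = [&& path e x s, sorted (fun a b => a != b) (edge_types M (x :: s))
                 & head o (edge_types M (x :: s)) == o].
Proof.
elim: s o x => [|y s IH] o x; first by rewrite /= eqxx.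
rewrite /= IH.
case exy: (e x y) => //=; case: (path e y s) => /=; last by rewrite andbF.
rewrite /edge_types /path_edges /=.
case: s {IH} => [|z s] /=; first by rewrite eqxx andbT.
set P := path _ _ _.
by case: (M x y); case: (M y z); case: o; case: P.
Qed.

Lemma alternatingP x s :
  alternating e M (x :: s) && ~~ head false (edge_types M (x :: s)) = apath x s.
Proof.
rewrite /alternating /apath altsE eqbF_neg [sorted e _]/=.
set A := uniq _; set B := path _ _ _; set C := sorted _ _; set D := head _ _.
by case: A; case: B; case: C; case: D.
Qed.

Lemma unmatchedF f y : unmatched M f -> M f y = false.
Proof. by move/forallP/(_ y)/negbTE. Qed.

Lemma alternating_unmatched f s :
  unmatched M f -> alternating e M (f :: s) = apath f s.
Proof.
move=> uf; rewrite -alternatingP.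
suff -> : head false (edge_types M (f :: s)) = false by rewrite andbT.
by case: s => [|y s] //=; apply: unmatchedF.
Qed.

Lemma reachesP o v p :
  reflect (exists f s, [/\ p = f :: s, unmatched M f, apath f s, last f s = v
                         & odd (size s) = o])
          (reaches e M o v p).
Proof.
apply: (iffP idP) => [/and3P[alt /eqP <- /existsP[f /andP[uf]]]|].
  case: p alt => //= z s alt /andP[/eqP zf /eqP <-].
  rewrite {z}zf in alt *; exists f, s; split=> //.
  by rewrite -alternating_unmatched.
move=> [f [s [-> uf ap <- <-]]]; rewrite /reaches alternating_unmatched // ap.
by rewrite eqxx /=; apply/existsP; exists f; rewrite uf /= !eqxx.
Qed.

Notation lv := (level e M).

Lemma reaches_uniq o v p : reaches e M o v p -> uniq p.
Proof. by case/reachesP=> f [s [-> _ /andP[]]]. Qed.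

Lemma lv_path o v (n : nat) : lv o v = Some n ->
  exists f s, [/\ unmatched M f, apath f s, last f s = v, size s = n & odd n = o].
Proof.
move=> lvn; have := min_lenP (@reaches_uniq o v).
rewrite /level in lvn; rewrite lvn => -[[p /reachesP[f [s [-> uf ap ls os]]] <-] _].
by exists f, s.
Qed.

Lemma lv_le f s : unmatched M f -> apath f s ->
  exists2 m : nat, lv (odd (size s)) (last f s) = Some m & m <= size s.
Proof.
move=> uf ap; have := min_lenP (@reaches_uniq (odd (size s)) (last f s)).
have rp : reaches e M (odd (size s)) (last f s) (f :: s).
  by apply/reachesP; exists f, s.
rewrite -/(level e M (odd (size s)) (last f s)).
by case: lv => [n [_ /(_ _ rp)]|/(_ (f :: s))/negP//]; exists n.
Qed.

Lemma lv_odd o v (n : nat) : lv o v = Some n -> odd n = o.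
Proof. by case/lv_path => f [s []]. Qed.

Lemma level_pathP o v p :
  reflect (exists f s, [/\ p = f :: s, unmatched M f, apath f s, last f s = v
                         & lv o v = Some (size s)])
          (level_path e M o v p).
Proof.
apply: (iffP andP) => [[/reachesP[f [s [-> uf ap ls os]]] /eqP lvs]|].
  by exists f, s.
move=> [f [s [-> uf ap ls lvs]]]; split; last by rewrite /level in lvs; rewrite lvs.
by apply/reachesP; exists f, s; split=> //; apply: lv_odd lvs.
Qed.

Lemma apath_cat x s1 s2 : apath x (s1 ++ s2) -> apath x s1.
Proof.
rewrite /apath alts_cat -cat_cons cat_uniq.
by move=> /andP[/andP[-> _] /and3P[-> _ _]].
Qed.

(** A walk beginning with an unmatched edge leaves its vertices at odd positions by their matched
    edge and enters those at even positions by it. So the mate is the neighbour on that side, unless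
    the walk has no edge there. *)
Lemma alts_mate x s1 s2 w : alts false x (s1 ++ s2) -> M (last x s1) w ->
  if odd (size s1) then s2 = [::] \/ exists s3, s2 = w :: s3
  else s1 = [::] \/ exists s3, s1 = rcons s3 (last x s1) /\ last x s3 = w.
Proof.
rewrite alts_cat => /andP[alt1 alt2] Mw; case: ifP => o1.
  case: s2 alt2 => [|y s2]; first by left.
  by rewrite o1 /= => /and3P[_ /eqP My _]; right; exists s2; rewrite (mate_uniq Mw My).
case/lastP: s1 alt1 {alt2} Mw o1 => [|s1 z]; first by left.
rewrite alts_rcons last_rcons size_rcons /= => /and3P[_ _ /eqP Mz] Mw /negbFE o1.
right; exists s1; split=> //; apply: (@mate_uniq z) => //.
by rewrite mate_sym Mz o1.
Qed.

(** An even path reaches [w] over its matched edge, and an odd path to [v] extends to [w]. For the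
    latter [w] must be off the path: otherwise [v] would be next to [w] on it, and so would occur
    twice or end a path of even length. *)
Lemma lv_matched v w : M v w ->
  lv false w = if lv true v is Some n then Some n.+1 else None.
Proof.
move=> Mvw; have Mwv : M w v by rewrite mate_sym.
have up (n : nat) : lv true v = Some n -> exists2 m : nat, lv false w = Some m & m <= n.+1.
  move=> /lv_path[f [s [uf /andP[alt un] ls sz on]]].
  have wN : w \notin f :: s.
    apply/negP => ws; case/splitPl: ws alt un ls sz => s1 s2 l1 alt.
    have := alts_mate (w := v) alt; rewrite l1 => /(_ Mwv).
    case: ifP => o1 [s0|[s3]].
    - by rewrite s0 cats0 l1 => _ wv; move: (matchingW Mwv); rewrite wv edge_irr.
    - move=> ->; rewrite -cat_cons cat_uniq last_cat size_cat /=.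
      case/and3P => _ _ /andP[vN _].
      case: s3 vN => [_ _|z s3 vN /= lz]; last by rewrite -lz mem_last in vN.
      by rewrite addn1 => sz; move: on; rewrite -sz /= o1.
    - by move: Mwv; rewrite -l1 s0 /= (unmatchedF v uf).
    move=> [-> l3]; rewrite -cat_cons cat_uniq last_cat last_rcons => /and3P[_ /hasPn vN _].
    case: s2 vN {alt} => [|z s2] vN lw _.
      by move: (matchingW Mwv); rewrite -lw /= edge_irr.
    have vzs : v \in z :: s2 by rewrite -lw /= mem_last.
    by have := vN v vzs; rewrite -rcons_cons mem_rcons inE -{2}l3 mem_last orbT.
  have ap : apath f (rcons s w).
    by rewrite /apath alts_rcons alt ls matchingW // sz on Mvw -rcons_cons rcons_uniq wN.
  by have [m] := lv_le uf ap; rewrite last_rcons size_rcons sz /= on => *; exists m.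
have down (n : nat) : lv false w = Some n -> exists2 m : nat, lv true v = Some m & m < n.
  move=> /lv_path[f [s [uf ap ls sz on]]].
  case: (lastP s) ls sz ap => [/= fw|s' z].
    by have := unmatchedF v uf; rewrite fw mate_sym Mvw.
  rewrite last_rcons size_rcons => -> sz ap.
  have [alt _] := andP ap; move: alt; rewrite alts_rcons => /and3P[_ _ /eqP Mlw].
  have os : odd (size s') by move: on; rewrite -sz /= => /negbFE.
  have lv1 : last f s' = v by apply: (@mate_uniq w); rewrite mate_sym // Mlw os.
  rewrite -cats1 in ap; have [m] := lv_le uf (apath_cat ap).
  by rewrite os lv1 => *; exists m; rewrite // -sz ltnS.
case E: (lv true v) => [n|]; case E': (lv false w) => [m|] //.
- have [m1 E1 le1] := up _ E; have [m2 E2 le2] := down _ E'.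
  by congr Some; move: E1 E2; rewrite E E' => -[?] [?]; subst; apply/eqP; rewrite eqn_leq le1.
- by have [m1] := up _ E; rewrite E'.
- by have [m1] := down _ E'; rewrite E.
Qed.

Lemma tenacity_matched v w : M v w -> tenacity e M v = tenacity e M w.
Proof.
move=> Mvw; rewrite /tenacity /evenlevel /oddlevel.
rewrite (lv_matched Mvw) (@lv_matched w v) 1?mate_sym //.
by case: (lv true v) => [a|]; case: (lv true w) => [b|] //=; congr Some; lia.
Qed.

(** Either the evenlevel path to [x] extends over the edge, or [y] is on that path and a proper
    prefix reaches it. *)
Lemma lv_edge x y (a : nat) : e x y -> M x y = false -> lv false x = Some a ->
  (exists2 m : nat, lv true y = Some m & m <= a.+1) \/
  (exists2 m : nat, lv false y = Some m & m < a).
Proof.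
move=> exy Mxy /lv_path[f [s [uf ap ls sz ev]]].
have [ys|yN] := boolP (y \in f :: s); last first.
  left; have ap' : apath f (rcons s y).
    move: ap; rewrite /apath alts_rcons ls exy sz ev Mxy -rcons_cons rcons_uniq yN.
    by rewrite !andbT.
  by have [m] := lv_le uf ap'; rewrite last_rcons size_rcons sz /= ev => *; exists m.
have [s1 [s2 [sE l1]]] := splitPlast ys; rewrite {}sE in ap ls sz.
have [m] := lv_le uf (apath_cat ap); rewrite l1.
have s2N : 0 < size s2.
  by case: (s2) ls => //; rewrite cats0 l1 => yx; move: exy; rewrite yx edge_irr.
have le1 : size s1 < a by move: sz; rewrite size_cat; lia.
by case: odd => lvm le_m; [left|right]; exists m => //; lia.
Qed.

Lemma lv_odd_pred v (k : nat) : lv true v = Some k ->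
  exists u (m : nat), [/\ e u v, M u v = false, lv false u = Some m & m < k].
Proof.
move=> /lv_path[f [s [uf ap ls sz od]]].
case: (lastP s) ls sz ap => [/= _ sz|s' z].
  by move: od; rewrite -sz.
rewrite last_rcons size_rcons => -> sz ap.
have [alt _] := andP ap; move: alt; rewrite alts_rcons => /and3P[_ euv /eqP Muv].
have os : odd (size s') = false by move: od; rewrite -sz /= => /negbTE.
rewrite -cats1 in ap; have [m] := lv_le uf (apath_cat ap).
by rewrite os => lvm le; exists (last f s'), m; split; rewrite // ?Muv ?os //; lia.
Qed.

Lemma tenacityE v (t : nat) : tenacity e M v = Some t ->
  exists a b : nat, [/\ lv false v = Some a, lv true v = Some b, t = a + b,
                  odd a = false & odd b = true].
Proof.
rewrite /tenacity /evenlevel /oddlevel.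
case Ea: (lv false v) => [a|]; case Eb: (lv true v) => [b|] //= [<-].
by exists a, b; split=> //; [apply: lv_odd Ea | apply: lv_odd Eb].
Qed.

Lemma unmatched_even f : unmatched M f -> lv false f = Some 0.
Proof.
move=> uf; have [|m] := @lv_le f [::] uf; first by [].
by rewrite /= leqn0 => -> /eqP ->.
Qed.

Lemma augmentingP p : reflect
  (exists f g s, [/\ f != g, unmatched M f, unmatched M g & [/\ p = f :: s, apath f s & last f s = g]])
  (augmenting e M p).
Proof.
apply: (iffP andP) => [[alt /existsP[f /existsP[g]]]|].
  case: p alt => [|z s] alt /and4P[fg uf ug] //= /andP[/eqP zf /eqP lg].
  subst z; exists f, g, s; split=> //; split=> //.
  by rewrite -alternating_unmatched.
move=> [f [g [s [fg uf ug [-> ap ls]]]]]; rewrite alternating_unmatched //.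
by split=> //; apply/existsP; exists f; apply/existsP; exists g; rewrite fg uf ug /= ls !eqxx.
Qed.

Definition below_l_m (n : nat) : bool := elt (Some n) (l_m e M).

Lemma below_l_mP n f g s : below_l_m n -> f != g -> unmatched M f ->
  unmatched M g -> apath f s -> last f s = g -> n < size s.
Proof.
rewrite /below_l_m /l_m => lt_n fg uf ug ap ls.
have au p : augmenting e M p -> uniq p.
  by case/augmentingP=> f' [g' [s' [_ _ _ [-> /andP[]]]]].
have := min_lenP au; have ag : augmenting e M (f :: s).
  by apply/augmentingP; exists f, g, s.
case: min_len lt_n => [L lt_n [_ /(_ _ ag)]|_ /(_ (f :: s))/negP//].
by apply: leq_trans; move: lt_n; rewrite /elt /= -ltnNge.
Qed.

Lemma outerP v : outer e M v ->
  exists2 a : nat, lv false v = Some a & forall c : nat, lv true v = Some c -> a < c.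
Proof.
rewrite /outer /evenlevel /oddlevel /elt.
case: (lv false v) => [a|]; last by case: (lv true v).
case: (lv true v) => [c|] /=; last by exists a.
by rewrite -ltnNge => lt; exists a => // d [<-].
Qed.

Lemma innerP v (a : nat) : ~~ outer e M v -> lv false v = Some a ->
  exists2 c : nat, lv true v = Some c & c < a.
Proof.
rewrite /outer /evenlevel /oddlevel /elt negbK => + lva; rewrite lva.
case lvc: (lv true v) => [c|] //= le; exists c => //.
by have := lv_odd lva; have := lv_odd lvc; lia.
Qed.

(** * Contracted classes *)

Definition small (s : nat) (v : V) : bool :=
  if tenacity e M v is Some t then t < s.*2 else false.

Lemma smallP s v : small s v -> exists a c : nat,
  [/\ lv false v = Some a, lv true v = Some c, a + c < s.*2,
      odd a = false & odd c = true].
Proof.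
rewrite /small; case E: (tenacity e M v) => [t|] // lt.
by have [a [c [? ? tE ? ?]]] := tenacityE E; exists a, c; split=> //; rewrite -tE.
Qed.

Lemma smallE s v (a c : nat) : lv false v = Some a -> lv true v = Some c ->
  small s v = (a + c < s.*2).
Proof. by rewrite /small /tenacity /evenlevel /oddlevel => -> ->. Qed.

Lemma small_mate s v w : M v w -> small s v = small s w.
Proof. by rewrite /small => /tenacity_matched ->. Qed.

Lemma small_le s s' v : s <= s' -> small s v -> small s' v.
Proof. by rewrite /small; case: tenacity => // t; lia. Qed.

Lemma inner_edge x y (a c : nat) : e x y -> M x y = false -> ~~ outer e M x ->
  lv false x = Some a -> lv false y = Some c ->
  exists2 k : nat, lv true x = Some k & k <= c.+1.
Proof.
move=> exy Mxy inx lva lvc; have [k lvk lt_k] := innerP inx lva.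
rewrite edge_sym in exy; rewrite mate_sym in Mxy.
exists k => //; case: (lv_edge exy Mxy lvc) => -[m]; rewrite ?lvk ?lva => -[<-]; lia.
Qed.

(* [b s v] is the base of the class of [v] when all edges of tenacity less than
   [2 * s] are contracted; [b s v = v] for bases and for trivial classes. *)
Definition otype (b : V -> V) (v : V) : bool := outer e M v || (b v != v).

(** The last two fields say that stage [s] is saturated. The edge in [cl_unmatched] has tenacity
    [a + c + 1]; the one in [cl_matched] joins two inner vertices, which then have the same oddlevel
    [k], so that its tenacity is [2k + 1]. The converse of [cl_small] is not demanded: it follows
    from the dual, see [classes_strong]. *)
Record classes (T : nat) (b : nat -> V -> V) : Prop := Classes {
  cl_mono : forall s s' v, s <= s' -> s' <= T -> b s' (b s v) = b s' v;
  cl_fix : forall s s' v, s <= s' -> s' <= T -> b s' v = v -> b s v = v;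
  cl_root : forall s f, s <= T -> unmatched M f -> b s f = f;
  cl_small : forall s v, s <= T -> b s v != v -> small s v;
  cl_mate : forall s v w, s <= T -> M v w -> b s v != v ->
    b s w = b s v /\ b s w != w;
  cl_outer : forall s v, s <= T -> b s v != v -> outer e M (b s v);
  cl_unmatched : forall s x y (a c : nat), s <= T -> e x y -> M x y = false ->
    otype (b s) x -> otype (b s) y ->
    lv false x = Some a -> lv false y = Some c -> a + c + 1 < s.*2 ->
    b s x = b s y;
  cl_matched : forall s x y (k : nat), s <= T -> M x y ->
    ~~ otype (b s) x -> ~~ otype (b s) y -> lv true x = Some k -> s <= k }.

Lemma classes_le T T' b : T' <= T -> classes T b -> classes T' b.
Proof.
move=> leT [h1 h2 h3 h4 h5 h6 h7 h8]; split.
- by move=> s s' v ? ?; apply: h1 => //; lia.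
- by move=> s s' v ? ?; apply: h2 => //; lia.
- by move=> s f ?; apply: h3; lia.
- by move=> s v ?; apply: h4; lia.
- by move=> s v w ?; apply: h5; lia.
- by move=> s v ?; apply: h6; lia.
- by move=> s x y a c ?; apply: h7; lia.
- by move=> s x y k ?; apply: h8; lia.
Qed.

(** * The dual solution and the lower bound on path lengths *)

Lemma sum_geq n k (P : pred nat) : (forall s, s < n -> P s = (k <= s)) ->
  \sum_(s < n) P s = n - k.
Proof.
elim: n => [|n IH] kP; first by rewrite big_ord0.
rewrite big_ord_recr /= kP // IH => [|s ?]; last by apply: kP; lia.
by case: (leqP k n) => ? /=; lia.
Qed.

Lemma sum_bool_eq0 n (P : pred nat) s :
  \sum_(s < n) P s = 0 -> s < n -> P s = false.
Proof.
move/eqP; rewrite sum_nat_eq0 => /forallP H sn.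
by have := H (Ordinal sn); rewrite /=; case: (P s).
Qed.

Lemma sum_geq_leq n k (P : pred nat) : (forall s, k <= s < n -> P s) ->
  n - k <= \sum_(s < n) P s.
Proof.
move=> kP; rewrite -(@sum_geq n k (fun s => k <= s)) //.
apply: leq_sum => s _; case: (leqP k s) => // ks.
by rewrite kP // ks ltn_ord.
Qed.

Section Dual.
Context (T : nat) (b : nat -> V -> V) (Hb : classes T b).
(** This stops short of stage [T], so that the section can be used at stage [T + 1] inside the
    induction that establishes it. *)
Hypothesis Hstrong : forall s v, s < T -> small s v -> b s v != v.

(* The dual solution of Edmonds' algorithm after [T] steps, shifted by [T] to
   stay in [nat]: an outer vertex starts to decrease at its evenlevel and an
   inner one increases from its oddlevel until it is absorbed by a blossom. *)
Definition Y (v : V) : nat :=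
  if b T v != v then odflt 0 (lv false v : option nat)
  else if outer e M v then minn (odflt 0 (lv false v : option nat)) T.+1
  else if lv true v is Some k then (if k <= T then T.*2.+1 - k else T.+1)
  else T.+1.

(** Each stage adds one unit to the weight of each of its classes; this is the total weight of the
    classes that contain both ends of an edge. It enters the constraints doubled. *)
Definition common (x y : V) : nat := \sum_(s < T.+1) (b s x == b s y).

Lemma cl_edge s x y (a c : nat) : s < T -> e x y -> M x y = false ->
  lv false x = Some a -> lv false y = Some c -> a + c + 1 < s.*2 -> b s x = b s y.
Proof.
move=> sT exy Mxy lva lvc lt.
have ot x' y' a' c' : e x' y' -> M x' y' = false -> lv false x' = Some a' ->
    lv false y' = Some c' -> a' + c' + 1 < s.*2 -> otype (b s) x'.
  move=> exy' Mxy' lva' lvc' lt'; rewrite /otype; case: (boolP (outer e M x')) => //= inx.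
  have [k lvk lek] := inner_edge exy' Mxy' inx lva' lvc'.
  by apply: Hstrong => //; rewrite (smallE s lva' lvk); lia.
apply: (cl_unmatched Hb _ exy Mxy (ot _ _ _ _ exy Mxy lva lvc lt) _ lva lvc lt); first lia.
by apply: (ot y x c a) => //; rewrite 1?edge_sym 1?mate_sym //; lia.
Qed.

(** The dual of a near vertex is its evenlevel, that of a far one exceeds [T]. Two far ends satisfy
    the edge constraint by size alone, so only an edge between a near and a far end needs a
    comparison of levels. *)
Definition near (v : V) : Prop :=
  otype (b T) v /\ exists2 a : nat, lv false v = Some a & Y v = a.
Definition far (v : V) : Prop :=
  [/\ b T v = v, Y v = T.+1 & exists a : nat,
     [/\ lv false v = Some a, outer e M v & T.+1 < a]] \/
  [/\ b T v = v, ~~ outer e M v, T < Y v &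
     forall k : nat, lv true v = Some k -> k <= T -> Y v = T.*2.+1 - k].

Lemma near_or_far v : near v \/ far v.
Proof.
rewrite /near /far /Y /otype; case: ifP => [bv|/negbFE/eqP bv].
  have [a [c [lva lvc _ _ _]]] := smallP (cl_small Hb (leqnn T) bv).
  by left; rewrite orbT; split=> //; exists a; rewrite lva.
case: ifP => ov.
  have [a lva _] := outerP ov; case: (leqP a T.+1) => leaT.
    by left; split=> //; exists a => //; rewrite lva /=; apply/minn_idPl.
  right; left; split=> //; last by exists a.
  by rewrite lva /=; apply/minn_idPr; lia.
right; right; split=> //.
  by case: (lv true v : option nat) => [k|//]; case: (leqP k T); lia.
by move=> k -> ->.
Qed.

Lemma edge_cases x y : e x y -> M x y = false ->
  [\/ exists a c : nat, [/\ otype (b T) x, otype (b T) y, lv false x = Some a,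
        lv false y = Some c & Y x = a /\ Y y = c],
      exists m c : nat, [/\ ~~ otype (b T) x, otype (b T) y, lv true x = Some m,
        lv false y = Some c & [/\ Y x = T.*2.+1 - m, Y y = c, m <= T & m <= c.+1]],
      exists m c : nat, [/\ ~~ otype (b T) y, otype (b T) x, lv true y = Some m,
        lv false x = Some c & [/\ Y y = T.*2.+1 - m, Y x = c, m <= T & m <= c.+1]]
    | T.*2 < Y x + Y y].
Proof.
have half x' y' : e x' y' -> M x' y' = false ->
    near x' -> T < Y y' /\ far y' ->
    (exists m c : nat, [/\ ~~ otype (b T) y', otype (b T) x', lv true y' = Some m,
        lv false x' = Some c & [/\ Y y' = T.*2.+1 - m, Y x' = c, m <= T & m <= c.+1]])
    \/ T.*2 < Y x' + Y y'.
  move=> exy Mxy [ox [c lvc Yx]] [ltY].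
  case: (ltnP T c) => leT; first by move=> _; right; lia.
  move=> [[by' Yy [a [lva oy lta]]]|[by' iny _ Yy]].
    have [a' + /(_ _) odlt] := outerP oy; rewrite lva => -[aE]; subst a'.
    case: (lv_edge exy Mxy lvc) => -[m]; first by move=> /odlt; lia.
    by rewrite lva => -[<-]; lia.
  have [m lvm lem] : exists2 m : nat, lv true y' = Some m & m <= c.+1.
    case: (lv_edge exy Mxy lvc) => -[m lvm lem]; first by exists m.
    by have [k lvk ltk] := innerP iny lvm; exists k => //; lia.
  case: (leqP m T) => mT.
    left; exists m, c; split=> //; first by rewrite /otype (negPf iny) by' eqxx.
    by split=> //; apply: Yy.
  by right; lia.
move=> exy Mxy; have eyx : e y x by rewrite edge_sym.
have Myx : M y x = false by rewrite mate_sym.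
have big z : far z -> T < Y z by case=> [[_ -> _]|[]].
case: (near_or_far x) (near_or_far y) => [X|X] [W|W].
- move: X W => [ox [a lva Yx]] [oy [c lvc Yy]].
  by constructor 1; exists a, c.
- case: (half x y exy Mxy X (conj (big _ W) W)) => [?|?]; [by constructor 3|by constructor 4].
- case: (half y x eyx Myx W (conj (big _ X) X)) => [?|?]; [by constructor 2|constructor 4; lia].
- by have := big _ X; have := big _ W; constructor 4; lia.
Qed.

(** For two near ends of evenlevels [a] and [c], a deficit of [a + c] against [2T] is made up by the
    stages [s] with [a + c + 1 < 2s], at each of which both ends have the same base. *)
Lemma dual_unmatched x y : e x y -> M x y = false ->
  T.*2 <= Y x + Y y + (common x y).*2.
Proof.
move=> exy Mxy; case: (edge_cases exy Mxy); try (by lia).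
- move=> [a [c [ox oy lva lvc [-> ->]]]].
  have [pa pc] := (lv_odd lva, lv_odd lvc).
  case: (leqP T.*2 (a + c)) => lt; first by lia.
  have : T.+1 - (a + c)./2.+1 <= common x y; last by lia.
  apply: (@sum_geq_leq T.+1 _ (fun s => b s x == b s y)) => s lts; apply/eqP.
  have lts' : a + c + 1 < s.*2 by lia.
  case: (ltnP s T) => sT; first exact: cl_edge lts'.
  by have sE : s = T; [lia|subst s; apply: (cl_unmatched Hb _ exy Mxy ox oy lva lvc)].
- by move=> [m [c [_ _ _ _ [-> -> ? ?]]]]; lia.
- by move=> [m [c [_ _ _ _ [-> -> ? ?]]]]; lia.
Qed.

Lemma tight_edge_cases x y : e x y -> M x y = false ->
  Y x + Y y + (common x y).*2 = T.*2 ->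
  [\/ exists a c : nat, [/\ otype (b T) x, otype (b T) y, lv false x = Some a,
        lv false y = Some c & a + c + (common x y).*2 = T.*2],
      exists c : nat, [/\ ~~ otype (b T) x, otype (b T) y, lv true x = Some c.+1,
         lv false y = Some c & c < T]
    | exists c : nat, [/\ ~~ otype (b T) y, otype (b T) x, lv true y = Some c.+1,
         lv false x = Some c & c < T]].
Proof.
move=> exy Mxy; case: (edge_cases exy Mxy); last by lia.
- by move=> [a [c [ox oy lva lvc [-> ->]]]] ?; constructor 1; exists a, c.
- move=> [m [c [ox oy lva lvc [-> -> ? ?]]]] ?; constructor 2; exists c.
  by have -> : c.+1 = m by lia.
- move=> [m [c [ox oy lva lvc [-> -> ? ?]]]] ?; constructor 3; exists c.
  by have -> : c.+1 = m by lia.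
Qed.

(** There are three configurations: both ends contracted, in a common class; an outer end of
    evenlevel [k + 1] and its inner mate of oddlevel [k]; or two inner ends, whose duals still are
    [T + 1] by [cl_matched]. *)
Lemma dual_matched x y : M x y -> Y x + Y y + (common x y).*2 = T.*2.+2.
Proof.
move=> Mxy; have Myx : M y x by rewrite mate_sym.
have xy : x != y by apply: contraTneq (matchingW Mxy) => ->; rewrite edge_irr.
case: (boolP (b T x != x)) => bx.
  have [byx byN] := cl_mate Hb (leqnn T) Mxy bx.
  have [a [c [lva lvc lt oa oc]]] := smallP (cl_small Hb (leqnn T) bx).
  have lvy : lv false y = Some c.+1 by rewrite (lv_matched Mxy) lvc.
  rewrite /Y bx byN lva lvy /=.
  have -> : common x y = T.+1 - (a + c)./2.+1; last by lia.
  apply: (@sum_geq T.+1 _ (fun s => b s x == b s y)) => s sT.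
  have smx : small s x = ((a + c)./2 < s) by rewrite (smallE s lva lvc); lia.
  rewrite -smx; case: (boolP (small s x)) => sm.
    have bsx : b s x != x.
      by case: (ltnP s T) => [?|?]; [apply: Hstrong|have -> : s = T by lia].
    by have [-> _] := cl_mate Hb sT Mxy bsx; rewrite eqxx.
  have smy : ~~ small s y by rewrite -(small_mate s Mxy).
  have fx : b s x = x by apply/eqP; apply: contraNT sm; apply: (cl_small Hb).
  have fy : b s y = y by apply/eqP; apply: contraNT smy; apply: (cl_small Hb).
  by rewrite fx fy (negPf xy).
move: bx; rewrite negbK => /eqP bx.
have byy : b T y = y.
  apply/eqP; apply/negPn/negP => byN.
  by have [_] := cl_mate Hb (leqnn T) Myx byN; rewrite bx eqxx.
have -> : common x y = 0.
  apply/eqP; rewrite sum_nat_eq0; apply/forallP => s /=.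
  have sT : s <= T by rewrite -ltnS.
  by rewrite (cl_fix Hb sT (leqnn T) bx) (cl_fix Hb sT (leqnn T) byy) (negPf xy).
have outY x' y' : M x' y' -> b T x' = x' -> b T y' = y' -> outer e M x' -> Y x' + Y y' = T.*2.+2.
  move=> Mxy' bx' by' ox; have [a lva odlt] := outerP ox.
  have Myx' : M y' x' by rewrite mate_sym.
  have [k [lvk aE]] : exists k : nat, lv true y' = Some k /\ a = k.+1.
    by move: lva; rewrite (lv_matched Myx'); case: (lv true y') => [k|] // [<-]; exists k.
  have iny : ~~ outer e M y'.
    apply: contraT => /negPn oy; have [c lvc odlt'] := outerP oy.
    have := odlt' _ lvk; move: lvc; rewrite (lv_matched Mxy').
    by case lvk': (lv true x') => [k'|] // [<-] ?; have := odlt _ lvk'; lia.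
  by rewrite /Y bx' by' !eqxx /= ox (negPf iny) lva lvk /=; case: leqP => ?; lia.
case: (boolP (outer e M x)) => [ox|inx]; first by have := outY _ _ Mxy bx byy ox; lia.
case: (boolP (outer e M y)) => [oy|iny]; first by have := outY _ _ Myx byy bx oy; lia.
have inY z z' : M z z' -> b T z = z -> b T z' = z' -> ~~ outer e M z -> ~~ outer e M z' -> Y z = T.+1.
  move=> Mz bz bz' inz inz'; rewrite /Y bz eqxx /= (negPf inz).
  case lvk: (lv true z) => [k|] //; case: leqP => // lek.
  have := cl_matched Hb (leqnn T) Mz; rewrite /otype bz bz' !eqxx !orbF => /(_ _ inz inz' lvk).
  by lia.
by rewrite (inY _ _ Mxy) // (inY _ _ Myx) //; lia.
Qed.

(** Telescoping the duals leaves a term for the classes of the last vertex: at an even position it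
    counts the stages whose base is off the path, at an odd position those that contract the vertex
    to a base on the path. *)
Definition missing (x : V) (s : seq V) (v : V) : nat :=
  \sum_(k < T.+1) (b k v \notin x :: s).
Definition hit (x : V) (s : seq V) (v : V) : nat :=
  \sum_(k < T.+1) ((b k v != v) && (b k v \in x :: s)).

(* [defect x s d]: the path exceeds the lower bound given by the dual by [d]. *)
Definition defect (x : V) (s : seq V) (d : nat) : Prop :=
  let v := last x s in
  if odd (size s) then size s + Y v + Y x + (hit x s v).*2 = T.*2.+1 + d
  else size s + Y x = Y v + (missing x s v).*2 + d.

Definition tight_step (x : V) (s : seq V) (w : V) : Prop :=
  Y (last x s) + Y w + (common (last x s) w).*2 = T.*2 /\
  forall k, k <= T -> b k (last x s) != b k w ->
    (b k (last x s) \in x :: s) && (b k w \notin x :: s).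

Definition tight (x : V) (s : seq V) : Prop := forall s1 s2, s = s1 ++ s2 ->
  defect x s1 0 /\ forall w s3, s2 = w :: s3 -> ~~ odd (size s1) -> tight_step x s1 w.

Lemma defect_unmatched x s w d : defect x s d -> ~~ odd (size s) ->
  e (last x s) w -> M (last x s) w = false -> uniq (x :: rcons s w) ->
  exists d', [/\ defect x (rcons s w) d', d <= d' & d' = 0 -> tight_step x s w].
Proof.
move=> + evs ev Mv; rewrite -rcons_cons rcons_uniq => + /andP[wN un].
rewrite /defect (negPf evs) size_rcons /= evs last_rcons; set v := last x s in ev Mv * => def.
have dual := dual_unmatched ev Mv.
pose g (k : nat) : bool := (b k v != b k w) && ~~ ((b k v \in x :: s) && (b k w \notin x :: s)).
have key : common v w + \sum_(k < T.+1) g k <= missing x s v + hit x (rcons s w) w.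
  rewrite /common /missing /hit -!big_split /=; apply: leq_sum => k _.
  rewrite /g -rcons_cons mem_rcons !inE.
  case: (eqVneq (b k v) (b k w)) => [<-|nvw] /=.
    case: (boolP (b k v == x)) => bx /=; last case: (boolP (b k v \in s)) => bs /=.
    - suff -> : b k v != w by rewrite orbT.
      by apply: contraNneq wN => <-; rewrite inE bx.
    - suff -> : b k v != w by rewrite !orbT.
      by apply: contraNneq wN => <-; rewrite inE bs orbT.
    - by case: (b k v == w).
  case: (boolP ((b k v == x) || _)) => bv //=.
  case: (boolP ((b k w == x) || _)) => bw /=; last by [].
  suff -> : b k w != w by rewrite orbT.
  by apply: contraNneq wN => <-; rewrite inE.
exists (size s + 1 + Y w + Y x + (hit x (rcons s w) w).*2 - T.*2.+1).
split; [by lia|by lia|move=> d0].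
have g0 : \sum_(k < T.+1) g k = 0 by lia.
split; first by rewrite -/v; lia.
move=> k kT nvw; have := sum_bool_eq0 g0 (kT : k < T.+1).
by rewrite /g -/v nvw /= => /negbFE.
Qed.

(** A stage that contracts [v] puts [w] into the same class with a base other than [w]; at any other
    stage both ends are their own bases. Together with the equality [dual_matched] nothing is gained
    or lost. *)
Lemma defect_matched x s w d : defect x s d -> odd (size s) ->
  M (last x s) w -> uniq (x :: rcons s w) -> defect x (rcons s w) d.
Proof.
move=> + ods Mv; rewrite -rcons_cons rcons_uniq => + /andP[wN un].
rewrite /defect ods size_rcons /= ods last_rcons; set v := last x s in Mv * => def.
have dual := dual_matched Mv; have Mw : M w v by rewrite mate_sym.
suff key : missing x (rcons s w) w + hit x s v = common v w by rewrite /=; lia.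
rewrite /common /missing /hit -!big_split /=; apply: eq_bigr => k _.
have kT : k <= T by rewrite -ltnS.
rewrite -rcons_cons mem_rcons [b k w \in w :: _]inE.
case: (boolP (b k v == v)) => bv; last first.
  have [bwv bw] := cl_mate Hb kT Mv bv; rewrite bwv eqxx /=.
  suff -> : b k v == w = false by case: (_ \in _).
  by apply: contraNF bw => /eqP bvw; rewrite bwv bvw.
have bw : b k w = w.
  apply/eqP/negPn/negP => bw.
  by have [_] := cl_mate Hb kT Mw bw; rewrite bv.
rewrite bw eqxx /= (eqP bv) (_ : v == w = false) //.
by apply/eqP => vw; move: (matchingW Mv); rewrite vw edge_irr.
Qed.

(** A start that is fixed at all stages has defect zero, and no step lowers the defect. Defect zero
    at the end therefore forces it at every prefix, and with it slackness of every unmatched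
    step. *)
Lemma lower_bound x s : apath x s -> (forall k, k <= T -> b k x = x) ->
  exists d, defect x s d /\ (d = 0 -> tight x s).
Proof.
move=> + fx; elim/last_ind: s => [|s w IH] ap.
  have m0 : missing x [::] x = 0.
    apply/eqP; rewrite sum_nat_eq0; apply/forallP => k /=.
    by rewrite fx ?mem_head // -ltnS.
  have d0 : defect x [::] 0 by rewrite /defect /= m0 add0n !addn0.
  by exists 0; split=> // _ [|//] [|//] _; split=> // w s3.
have ap' : apath x s by move: ap; rewrite -cats1; apply: apath_cat.
have [d [def tgt]] := IH ap'; move: ap; rewrite /apath alts_rcons.
case/andP => /and3P[_ ev /eqP Mv] un.
have ext d' : defect x (rcons s w) d' -> d' = 0 -> (d' = 0 -> d = 0) ->
    (~~ odd (size s) -> tight_step x s w) -> tight x (rcons s w).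
  move=> def' d0 dd st s1 s2; case/lastP: s2 => [|s2 z].
    rewrite cats0 => <-; split; first by rewrite d0 in def'.
    by [].
  rewrite -rcons_cat => /rcons_inj[sE zE]; rewrite -{}zE.
  have [d1 st1] := tgt (dd d0) _ _ sE; split=> // w' s3; case: s2 sE st1 => [|y s2] sE st1.
    by rewrite cats0 in sE; rewrite -sE => -[<- _]; apply: st.
  by rewrite rcons_cons => -[<- _]; apply: st1.
case: (boolP (odd (size s))) => ods.
  exists d; have def' : defect x (rcons s w) d.
    by apply: defect_matched => //; rewrite Mv ods.
  by split=> // d0; apply: ext def' d0 _ _; rewrite ?ods.
have Mv' : M (last x s) w = false by rewrite Mv (negPf ods).
have [d' [def' ledd st]] := defect_unmatched def ods ev Mv' un.
by exists d'; split=> // d0; apply: (ext d' def' d0) => [?|_]; [lia|apply: st].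
Qed.

End Dual.
Section DualBounds.
Context (T : nat) (b : nat -> V -> V) (Hb : classes T b).

Lemma Y_root f : unmatched M f -> Y T b f = 0.
Proof.
move=> uf; rewrite /Y (cl_root Hb) // eqxx /=.
have -> : outer e M f.
  rewrite /outer /evenlevel /oddlevel (unmatched_even uf) /elt.
  by case E: (lv true f) => [c|] //=; have := lv_odd E; case: c E.
by rewrite (unmatched_even uf) /= min0n.
Qed.

Lemma root_fixed f k : unmatched M f -> k <= T -> b k f = f.
Proof. by move=> uf kT; apply: cl_root Hb _ _ kT uf. Qed.

End DualBounds.

(** Converse of [cl_small]. If [v] is fixed at stage [T + 1], then it is fixed at all earlier
    stages, its dual is determined by its smaller level, and the bound on a path attaining the
    larger level has no useful class term. The two levels then add up to at least [2T + 3], too much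
    for a small vertex. *)
Lemma classes_strong T b s v : classes T b -> s <= T -> small s v -> b s v != v.
Proof.
elim: T s v => [|T IH] s v Hb.
  by rewrite leqn0 => /eqP -> /smallP[a [c []]].
rewrite leq_eqVlt => /predU1P[->|]; last first.
  by rewrite ltnS => sT; apply: IH => //; apply: classes_le Hb.
have Hs s' v' : s' < T.+1 -> small s' v' -> b s' v' != v'.
  by rewrite ltnS => sT; apply: IH => //; apply: classes_le Hb.
move=> sm; apply/negP => /eqP bv; have [a [c [lva lvc lt oa oc]]] := smallP sm.
have fx k : k <= T.+1 -> b k v = v by move=> kT; apply: (cl_fix Hb kT (leqnn _) bv).
case: (boolP (outer e M v)) => [ov|inv].
  have [f [s' [uf ap ls sz od]]] := lv_path lvc.
  have [d [+ _]] := lower_bound Hb Hs ap (fun k => root_fixed Hb uf).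
  have [a' + /(_ _ lvc) ltac] := outerP ov; rewrite lva => -[?]; subst a'.
  rewrite /defect sz od (Y_root Hb uf) ls.
  have -> : hit T.+1 b f s' v = 0.
    apply/eqP; rewrite sum_nat_eq0; apply/forallP => k /=.
    by rewrite fx ?eqxx // -ltnS.
  have -> : Y T.+1 b v = a.
    by rewrite /Y bv eqxx /= ov lva /=; apply/minn_idPl; lia.
  by lia.
have [f [s' [uf ap ls sz od]]] := lv_path lva.
have [d [+ _]] := lower_bound Hb Hs ap (fun k => root_fixed Hb uf).
have [c' + ltca] := innerP inv lva; rewrite lvc => -[?]; subst c'.
rewrite /defect sz od (Y_root Hb uf) ls.
have -> : Y T.+1 b v = T.+1.*2.+1 - c.
  by rewrite /Y bv eqxx /= (negPf inv) lvc ifT //; lia.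
by lia.
Qed.

(** * Tight paths and the shape of level paths *)

Section Tight.
Context (T : nat) (b : nat -> V -> V) (Hb : classes T b).
Let Hs s v (sT : s < T) : small s v -> b s v != v.
Proof. exact: classes_strong Hb (ltnW sT). Qed.

Lemma cl_smallE s v : s <= T -> (b s v != v) = small s v.
Proof.
move=> sT; apply/idP/idP; first exact: cl_small Hb _ _ sT.
exact: classes_strong Hb sT.
Qed.

Lemma cl_idem s v : s <= T -> b s (b s v) = b s v.
Proof. by move=> sT; exact: (cl_mono Hb v (leqnn s) sT). Qed.

Lemma base_fixed k v : k <= T -> b k (b T v) = b T v.
Proof. by move=> kT; apply: (cl_fix Hb kT (leqnn T)); apply: cl_idem. Qed.

(** The range includes tenacity [2T + 1], not yet contracted: there the dual [2T + 1 - c] of an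
    inner vertex of oddlevel [c] is just its evenlevel. *)
Lemma Y_small v (a c : nat) : lv false v = Some a -> lv true v = Some c ->
  a + c <= T.*2.+1 -> Y T b v = a.
Proof.
move=> lva lvc le; rewrite /Y; case: ifP => [_|/negbFE/eqP bv]; first by rewrite lva.
have : ~~ small T v by rewrite -cl_smallE // bv eqxx.
rewrite (smallE T lva lvc) => lt; have [oa oc] := (lv_odd lva, lv_odd lvc).
case: ifP => [/outerP[a' + /(_ _ lvc)]|/negbT/innerP/(_ lva)[c' + ltc]].
  by rewrite lva => -[<-] /= ?; apply/minn_idPl; lia.
by rewrite lvc => -[?]; subst c'; rewrite ifT; lia.
Qed.

(** At an odd position [hit] is at most the number [cnt] of stages contracting the end, which its
    tenacity determines; at an even position [missing] can only lengthen the path. Equality leaves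
    no room for a base of the end off the path. *)
Lemma level_bound x s (n : nat) : apath x s -> (forall k, k <= T -> b k x = x) ->
  small T.+1 (last x s) -> lv (odd (size s)) (last x s) = Some n ->
  n <= size s + Y T b x /\
  (size s + Y T b x <= n ->
    tight T b x s /\ forall k, k <= T -> b k (last x s) \in x :: s).
Proof.
move=> ap fx /smallP[a [c [lva lvc lt oa oc]]] lvn.
have [d [def tgt]] := lower_bound Hb Hs ap fx.
have Ya : Y T b (last x s) = a by apply: Y_small lva lvc _; lia.
move: def lvn; rewrite /defect Ya; set v := last x s in lva lvc *.
case: ifP => od.
  rewrite lvc => def [cn]; subst n.
  have cnt : \sum_(k < T.+1) (b k v != v) = T.+1 - (a + c)./2.+1.
    apply: (@sum_geq T.+1 _ (fun k => b k v != v)) => k kT.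
    by rewrite cl_smallE // (smallE k lva lvc); lia.
  pose g (k : nat) := (b k v != v) && (b k v \notin x :: s).
  have key : hit T b x s v + \sum_(k < T.+1) g k = \sum_(k < T.+1) (b k v != v).
    by rewrite /hit -big_split; apply: eq_bigr => k _; rewrite /g; case: eqP; case: (_ \in _).
  split=> [|le]; first by lia.
  split=> [|k kT]; first by apply: tgt; lia.
  have g0 : \sum_(k < T.+1) g k = 0 by lia.
  have := sum_bool_eq0 g0 (kT : k < T.+1); rewrite /g.
  by case: eqP => [-> _|_ /negbFE] //; rewrite mem_last.
rewrite lva => def [cn]; subst n; split=> [|le]; first by lia.
split=> [|k kT]; first by apply: tgt; lia.
have g0 : missing T b x s v = 0 by lia.
apply: negbFE.
exact: (@sum_bool_eq0 T.+1 (fun k => b k v \notin x :: s) k g0 kT).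
Qed.

Lemma tight_prefix x s1 s2 : tight T b x (s1 ++ s2) -> tight T b x s1.
Proof.
move=> tgt t1 t2 sE; have [] := tgt t1 (t2 ++ s2); first by rewrite sE catA.
by move=> d0 st; split=> // w s3 t2E; apply: (st w (s3 ++ s2)); rewrite t2E.
Qed.

(** Induction backwards from the end. An unmatched edge could enter the class only if the base were
    not yet visited, but it lies behind; a matched edge crosses the boundary of a class only at the
    base. The prefix is even, since otherwise the path would leave the base by its matched edge, out
    of the class. *)
Lemma tight_tail k x s : k <= T -> alts false x s -> uniq (x :: s) -> tight T b x s ->
  b k (last x s) \in x :: s -> b k (last x s) != last x s ->
  exists s1 s2 : seq V, [/\ s = s1 ++ s2, last x s1 = b k (last x s), ~~ odd (size s1)
    & all (fun w => (b k w == b k (last x s)) && (b k w != w)) s2].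
Proof.
move=> kT alt un tgt bin bN; have [s1 [s2 [sE l1]]] := splitPlast bin.
have [v lv1] : exists v, last x s = v by exists (last x s).
rewrite lv1 in bN l1 * => {bin}.
have bk : b k (b k v) = b k v by apply: cl_idem.
suff al : all (fun w => (b k w == b k v) && (b k w != w)) s2.
  exists s1, s2; split=> //; apply/negP => o1.
  move: alt lv1; rewrite sE alts_cat last_cat l1 => /andP[_].
  case: s2 al {sE} => [_ _ /= bv|y s2 /=]; first by rewrite bv eqxx in bN.
  rewrite o1 => /andP[/andP[_ yN] _] /and3P[_ /eqP My _] _.
  have Myb : M y (b k v) by rewrite mate_sym.
  by have [_] := cl_mate Hb kT Myb yN; rewrite bk eqxx.
have {lv1} : b k (last x s) = b k v /\ b k (last x s) != last x s by rewrite lv1.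
move: sE alt un tgt; elim/last_ind: s2 s => [//|s2 y IH] s sE.
rewrite {}sE -rcons_cat => alt un tgt; rewrite last_rcons => -[by1 yN].
rewrite all_rcons yN by1 eqxx /=.
have alt' : alts false x (s1 ++ s2) by move: alt; rewrite alts_rcons => /andP[].
have un' : uniq (x :: s1 ++ s2).
  by move: un; rewrite -rcons_cons rcons_uniq => /andP[].
have tgt' : tight T b x (s1 ++ s2) by move: tgt; rewrite -cats1; apply: tight_prefix.
case: (lastP s2) IH alt un tgt alt' un' tgt' => [//|s3 z] IH alt un tgt alt' un' tgt'.
have byk : b k v \in x :: (s1 ++ rcons s3 z).
  by rewrite -cat_cons mem_cat -l1 mem_last.
have lz : last x (s1 ++ rcons s3 z) = z by rewrite last_cat last_rcons.
have zN : z != b k v.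
  move: un'; rewrite -cat_cons cat_uniq => /and3P[_ /hasPn/(_ z) + _].
  rewrite mem_rcons mem_head => /(_ isT); apply: contraNneq => ->.
  by rewrite -l1 mem_last.
apply: (IH _ (erefl _) alt' un' tgt'); rewrite lz.
suff bz : b k z = b k v by rewrite bz eq_sym.
move: alt; rewrite alts_rcons lz => /and3P[_ _ /eqP Mzy].
have [od|od] := boolP (odd (size (s1 ++ rcons s3 z))).
  have Myz : M y z by rewrite mate_sym Mzy od.
  by have [-> _] := cl_mate Hb kT Myz yN.
have [_ st] := tgt (s1 ++ rcons s3 z) [:: y] (esym (cats1 _ _)).
have [_ /(_ k kT)] := st _ _ erefl od.
rewrite lz by1; case: eqP => // _ /(_ isT)/andP[_].
by rewrite byk.
Qed.

(** If the base of [u] were off the path, the path could not leave the class of [u]: an unmatched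
    edge does so only with the base behind it, a matched one only from the base. The end would then
    have the base of [u] as its own, and that base is on the path. *)
Lemma tight_visited k x s u : k <= T -> alts false x s -> uniq (x :: s) ->
  tight T b x s -> u \in x :: s -> b k (last x s) \in x :: s -> b k u \in x :: s.
Proof.
move=> kT alt un tgt uin bin; have [s1 [s2 [sE l1]]] := splitPlast uin.
apply/negPn/negP => bu.
suff bl : b k (last x s) = b k u by rewrite -bl bin in bu.
have uN w : b k w = b k u -> w \in x :: s -> b k w != w.
  by move=> -> win; apply: contraNneq bu => ->.
suff gen s' : s' = s1 ++ s2 -> alts false x s' -> uniq (x :: s') ->
  tight T b x s' -> {subset x :: s' <= x :: s} -> b k (last x s') = b k u by exact: gen.
move=> {sE alt un tgt bin}; elim/last_ind: s2 s' => [|s2 y IH] s' ->.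
  by rewrite cats0 l1.
rewrite -rcons_cat last_rcons => alt un tgt sub.
have tgt' : tight T b x (s1 ++ s2) by move: tgt; rewrite -cats1; apply: tight_prefix.
have alt' : alts false x (s1 ++ s2) by move: alt; rewrite alts_rcons => /andP[].
have un' : uniq (x :: s1 ++ s2).
  by move: un; rewrite -rcons_cons rcons_uniq => /andP[].
have sub' w : w \in x :: s1 ++ s2 -> w \in x :: s.
  by move=> win; apply: sub; rewrite -rcons_cons mem_rcons inE win orbT.
have bl := IH _ erefl alt' un' tgt' sub'.
have lN := uN _ bl (sub' _ (mem_last _ _)).
move: alt; rewrite alts_rcons => /and3P[_ _ /eqP My].
case: (boolP (odd (size (s1 ++ s2)))) => od.
  have My' : M (last x (s1 ++ s2)) y by rewrite My od.
  by have [-> _] := cl_mate Hb kT My' lN.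
have [_ st] := tgt (s1 ++ s2) [:: y] (esym (cats1 _ _)).
have [_ /(_ k kT)] := st _ _ erefl od.
rewrite bl; case: eqP => // _ /(_ isT)/andP[bin].
by rewrite (sub' _ bin) in bu.
Qed.

(** A level path is tight and visits the base, after which it stays in the class. The first part is
    shortest: the base is fixed at all stages, so defect zero makes its length the dual of the base,
    which is at most the evenlevel. *)
Lemma class_decomp v f s : small T v -> unmatched M f -> apath f s ->
  last f s = v -> lv (odd (size s)) v = Some (size s) ->
  exists s1 s2 : seq V, [/\ s = s1 ++ s2, last f s1 = b T v, ~~ odd (size s1),
    lv false (b T v) = Some (size s1) /\ Y T b (b T v) = size s1
    & all (fun w => (b T w == b T v) && (b T w != w)) s2].
Proof.
move=> sm uf ap ls lvs; have bv : b T v != v by rewrite cl_smallE.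
have := @level_bound _ _ (size s) ap (fun k => root_fixed Hb uf).
rewrite ls => /(_ (small_le (leqnSn T) sm) lvs)[_].
rewrite (Y_root Hb uf) addn0 => /(_ (leqnn _))[tgt /(_ T (leqnn T)) bin].
have [alt un] := andP ap; rewrite -{1}ls in bin.
have := tight_tail (leqnn T) alt un tgt bin; rewrite ls => /(_ bv)[s1 [s2 [sE l1 o1 al]]].
exists s1, s2; split=> //; rewrite sE in ap tgt.
have [m lvm lem] := lv_le uf (apath_cat ap); rewrite (negPf o1) l1 in lvm.
have [+ _] := tgt s1 s2 erefl; rewrite /defect (negPf o1) l1 (Y_root Hb uf) addn0.
have -> : missing T b f s1 (b T v) = 0.
  apply/eqP; rewrite sum_nat_eq0; apply/forallP => k /=.
  by rewrite base_fixed -1?ltnS // -l1 mem_last.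
have : Y T b (b T v) <= m.
  rewrite /Y base_fixed // eqxx /= (cl_outer Hb (leqnn T) bv) lvm /=.
  exact: geq_minl.
by rewrite lvm => ? ?; split; [congr Some; lia|lia].
Qed.

Lemma base_level v : small T v -> exists2 m : nat, lv false (b T v) = Some m
  & Y T b (b T v) = m.
Proof.
move=> sm; have [a [_ [lva _ _ oa _]]] := smallP sm.
have [f [s [uf ap ls sz _]]] := lv_path lva.
have [|s1 [_ [_ _ _ [lv1 Y1] _]]] := class_decomp sm uf ap ls _.
  by rewrite sz oa.
by exists (size s1).
Qed.

Lemma base_path v r (m n : nat) : small T v -> apath (b T v) r -> last (b T v) r = v ->
  lv false (b T v) = Some m -> lv (odd (size r)) v = Some n ->
  n <= size r + m /\ (size r + m <= n -> tight T b (b T v) r /\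
    all (fun w => (b T w == b T v) && (b T w != w)) r).
Proof.
move=> sm ap lr lvm lvn; have [m' ] := base_level sm; rewrite lvm => -[<-] Ym.
have fx k : k <= T -> b k (b T v) = b T v by apply: base_fixed.
have := @level_bound _ _ n ap fx; rewrite lr Ym => /(_ (small_le (leqnSn T) sm) lvn).
move=> [len tgt]; split=> // /tgt[{}tgt bin]; split=> //.
have [alt un] := andP ap; have bv : b T v != v by rewrite cl_smallE.
have := tight_tail (leqnn T) alt un tgt; rewrite lr => /(_ (bin T (leqnn T)) bv).
move=> [s1 [s2 [rE l1 _ al]]]; suff s10 : s1 = [::] by rewrite rE s10.
case: (lastP s1) l1 rE => // s1' z; rewrite last_rcons => -> rE.
by move: un; rewrite rE /= mem_cat mem_rcons mem_head.
Qed.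

End Tight.

(** * From stage [T] to stage [T + 1] *)

Lemma root_not_small T f : below_l_m T.*2.+1 -> unmatched M f -> ~~ small T.+1 f.
Proof.
move=> lt uf; apply/negP => /smallP[a [c [lva lvc ltac oa oc]]].
have [f' [s [uf' ap ls sz _]]] := lv_path lvc.
(* An odd path does not return to its own start, so this one is augmenting. *)
have ff' : f' != f.
  apply: contraTneq ap => ff'; rewrite /apath; case: (lastP s) ls sz => [_ sz|s' z].
    by move: oc; rewrite -sz.
  by rewrite last_rcons ff' => -> _; rewrite /= mem_rcons mem_head /= andbF.
by have := below_l_mP lt ff' uf' uf ap ls; rewrite sz; lia_nat.
Qed.

(** A partial contraction between stages [T] and [T + 1]. As no dual accompanies it, [gr_path]
    carries level paths through the base for both parities. *)
Record growing (T : nat) (b : nat -> V -> V) (g : V -> V) : Prop := Growing {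
  gr_idem : forall v, g (g v) = g v;
  gr_coarse : forall v, g (b T v) = g v;
  gr_fix : forall v, g v = v -> b T v = v;
  gr_small : forall v, g v != v -> small T.+1 v;
  gr_mate : forall v w, M v w -> g v != v -> g w = g v /\ g w != w;
  gr_outer : forall v, g v != v -> outer e M (g v);
  gr_path : forall v o, g v != v -> exists (r : seq V) (n m : nat),
    [/\ apath (g v) r, last (g v) r = v, odd (size r) = o,
        lv o v = Some n /\ lv false (g v) = Some m
      & n = m + size r /\ all (fun w => g w == g v) r] }.

Lemma growing_init T b : classes T b -> growing T b (b T).
Proof.
move=> Hb; split.
- by move=> v; apply: (cl_idem Hb v (leqnn T)).
- by move=> v; apply: (cl_idem Hb v (leqnn T)).
- by [].
- by move=> v bv; apply: (small_le (leqnSn T)); apply: (cl_small Hb (leqnn T) bv).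
- by move=> v w Mvw bv; apply: (cl_mate Hb (leqnn T) Mvw bv).
- by move=> v bv; apply: (cl_outer Hb (leqnn T) bv).
move=> v o bv; have sm : small T v by rewrite -(cl_smallE Hb _ (leqnn T)).
have [n lvn] : exists n : nat, lv o v = Some n.
  by have [a [c [lva lvc _ _ _]]] := smallP sm; case: o; [exists c|exists a].
have [f [s [uf ap ls sz od]]] := lv_path lvn.
have [|s1 [s2 [sE l1 o1 [lvb _] al]]] := class_decomp Hb sm uf ap ls _.
  by rewrite sz od.
exists s2, n, (size s1).
move: ap; rewrite /apath sE alts_cat l1 (negPf o1) -cat_cons cat_uniq.
case/andP=> /andP[alt1 alt2] /and3P[un1 /hasPn dis un2].
split=> //.
- rewrite alt2 /= un2 andbT; apply/negP => bs2.
  by have := dis _ bs2; rewrite -l1 mem_last.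
- by move: ls; rewrite sE last_cat l1.
- by rewrite -od -sz sE size_cat oddD (negPf o1).
- by rewrite -sz sE size_cat; split=> //; apply: sub_all al => w /andP[].
Qed.

Section Grow.
Context (T : nat) (b : nat -> V -> V) (Hb : classes T b).
Hypothesis Hlm : below_l_m T.*2.+1.

Section Core.
Context (g : V -> V) (Hg : growing T b g).

Lemma otype_path x : otype g x -> exists (r : seq V) (a m : nat),
  [/\ apath (g x) r, last (g x) r = x, odd (size r) = false,
      lv false x = Some a /\ lv false (g x) = Some m
    & [/\ a = m + size r, all (fun w => g w == g x) r & outer e M (g x)]].
Proof.
rewrite /otype; case: (boolP (g x == x)) => [/eqP gx|gx _].
  rewrite orbF => ox; have [a lva _] := outerP ox.
  by exists [::], a, a; rewrite gx addn0 ox.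
have [r [a [m [ap lr od [lva lvm] [aE al]]]]] := gr_path Hg false gx.
by exists r, a, m; split=> //; split=> //; apply: (gr_outer Hg gx).
Qed.

Lemma class_level w o (n m : nat) : lv false (g w) = Some m -> lv o w = Some n ->
  g w != w -> m <= n.
Proof.
move=> lvm lvn gw; have [r [n' [m' [_ _ _ [lvn' lvm'] [nE _]]]]] := gr_path Hg o gw.
by move: lvn' lvm'; rewrite lvm lvn nE => -[->] [->]; apply: leq_addr.
Qed.

Lemma base_le_T w (m : nat) : lv false (g w) = Some m -> g w != w -> m <= T.
Proof.
move=> lvm gw; have [a [c [lva lvc lt _ _]]] := smallP (gr_small Hg gw).
by have := class_level lvm lva gw; have := class_level lvm lvc gw; lia_nat.
Qed.

(* [K] is the part of an alternating walk between [x] and [y] outside the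
   classes of its ends; the walk closes up around a bridge of tenacity
   [2 * T + 1]. *)
Record core (x : V) (K : seq V) (y : V) (mx my : nat) : Prop := Core {
  co_alts : alts false x (rcons K y);
  co_even : odd (size K) = false;
  co_uniq : uniq K;
  co_closed : forall w, w \in K -> g w \in K;
  co_x : g x \notin K;
  co_y : g y \notin K;
  co_ox : otype g x;
  co_oy : otype g y;
  co_size : exists a c : nat,
    [/\ lv false x = Some a, lv false y = Some c & size K + a + c = T.*2];
  co_mx : lv false (g x) = Some mx /\ mx <= T;
  co_my : lv false (g y) = Some my /\ my <= T;
  co_level : forall w o (n : nat), w \in K -> lv o w = Some n ->
    mx <= n.+1 /\ my <= n.+1 }.

Lemma core_sym x K y mx my : core x K y mx my -> core y (rev K) x my mx.
Proof.
case=> alt ev un cl cx cy ox oy [a [c [lva lvc sz]]] hx hy le.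
split; rewrite ?size_rev ?rev_uniq ?mem_rev //.
- have := alts_rev alt; rewrite last_rcons size_rcons /= ev /=.
  by rewrite belast_rcons rev_cons.
- by move=> w; rewrite !mem_rev; apply: cl.
- by exists c, a; split=> //; lia_nat.
- by move=> w o n; rewrite mem_rev => win /(le _ _ _ win)[].
Qed.

Lemma core_mate x K y mx my w z : core x K y mx my -> w \in K -> M w z -> z \in K.
Proof.
move=> co win Mwz; have xK : x \notin K.
  by apply: contra (co_x co) => /(co_closed co).
have [s1 [s2 [KE l1]]] : exists s1 s2 : seq V, K = s1 ++ s2 /\ last x s1 = w.
  by apply: splitPlast; rewrite inE win orbT.
have s1N : s1 <> [::] by move=> s10; move: xK; rewrite -[x]/(last x [::]) -s10 l1 win.
have := co_alts co; rewrite KE rcons_cat => alt.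
have := co_even co; rewrite KE size_cat oddD.
have := alts_mate alt; rewrite l1 => /(_ _ Mwz).
case: ifP => o1 [//|].
- by case: (s2) => //.
- move=> [s3]; case: s2 {alt} KE => [|y' s2] KE //= [-> _] _.
  by rewrite mem_cat mem_head orbT.
- move=> [s3 [s1E l3]] _.
  case: (lastP s3) l3 s1E => [|s3' z' l3 s1E].
    by move=> _ s1E; move: o1; rewrite s1E.
  by rewrite s1E mem_cat mem_rcons inE -l3 last_rcons mem_rcons mem_head orbT.
Qed.

(** Completed inside the two end classes to their bases, the walk would be an augmenting path of
    length [2T + 1]. *)
Lemma core_no_roots x K y mx my : core x K y mx my -> g x != g y ->
  unmatched M (g x) -> unmatched M (g y) -> False.
Proof.
move=> co gxy ux uy.
have [rx [a [m [apx lrx ox [lva lvm] [aE alx _]]]]] := otype_path (co_ox co).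
have [ry [c [m' [apy lry oy [lvc lvm'] [cE aly _]]]]] := otype_path (co_oy co).
have [a' [c' []]] := co_size co; rewrite lva lvc => -[?] [?] sz; subst a' c'.
have m0 : m = 0 by move: lvm; rewrite (unmatched_even ux) => -[].
have m'0 : m' = 0 by move: lvm'; rewrite (unmatched_even uy) => -[].
pose s := rx ++ (rcons K y ++ rev (belast (g y) ry)).
have [altx unx] := andP apx; have [alty uny] := andP apy.
have yE : y :: rev (belast (g y) ry) = rev (g y :: ry).
  by rewrite (lastI (g y) ry) lry rev_rcons.
have ap : apath (g x) s.
  apply/andP; split.
    rewrite /s !alts_cat altx lrx ox (co_alts co) last_rcons size_rcons /= (co_even co) /=.
    by have := alts_rev alty; rewrite lry oy.
  rewrite /s -cat_cons cat_uniq unx cat_rcons cat_uniq yE rev_uniq uny (co_uniq co) /= andbT.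
  apply/andP; split; last first.
    apply/hasPn => w; rewrite mem_rev inE => win; apply/negP => wK.
    have := co_closed co wK; suff -> : g w = g y by apply/negP; apply: co_y co.
    case/predU1P: win => [->|/(allP aly)/eqP//]; exact: gr_idem Hg y.
  apply/hasPn => w; rewrite mem_cat mem_rev => win; apply/negP => wx.
  have gw : g w = g x.
    case/predU1P: wx => [->|/(allP alx)/eqP//]; exact: gr_idem Hg x.
  case/orP: win => [/(co_closed co)|win]; first by rewrite gw; apply/negP; apply: co_x co.
  move: gxy; rewrite -gw; case/predU1P: win => [->|/(allP aly)/eqP ->].
    by rewrite (gr_idem Hg) eqxx.
  by rewrite eqxx.
have ls : last (g x) s = g y.
  rewrite /s !last_cat last_rcons; case: (ry) lry => [//|z r' _ /=].
  by rewrite rev_cons last_rcons.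
have := below_l_mP Hlm gxy ux uy ap ls.
rewrite /s !size_cat size_rcons size_rev size_belast.
by move: sz aE cE; rewrite m0 m'0; clear; lia_nat.
Qed.

Lemma even0_unmatched v : lv false v = Some 0 -> unmatched M v.
Proof. by case/lv_path => f [s [uf _ <- /size0nil -> _]]. Qed.

(** The predecessor has outer type: if [u] is inner, its oddlevel is below its evenlevel [m <= T],
    so its tenacity is below [2T] and it is contracted already. *)
Lemma inner_pred v (k : nat) : ~~ outer e M v -> lv true v = Some k -> k <= T.+1 ->
  exists u (m : nat), [/\ e u v, M u v = false, k = m.+1, lv false u = Some m & otype g u].
Proof.
move=> inv lvk leT; have [u [m [euv Muv lvm ltmk]]] := lv_odd_pred lvk.
have kE : k = m.+1.
  case: (lv_edge euv Muv lvm) => -[n]; first by rewrite lvk => -[<-]; lia_nat.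
  move=> lvn ltn; have [c] := innerP inv lvn; rewrite lvk => -[<-]; lia_nat.
exists u, m; split=> //; rewrite /otype; case: (boolP (outer e M u)) => //= inu.
have [c lvc ltc] := innerP inu lvm.
apply: contraT => /negPn/eqP/(gr_fix Hg) fu.
have : small T u by rewrite (smallE T lvm lvc); lia_nat.
by rewrite -(cl_smallE Hb _ (leqnn T)) fu eqxx.
Qed.

(** The walk is prolonged from [x] through its class to [g x], over the mate [z], to the vertex [u]
    before [z] on a shortest odd path. Since [x] is on the farther side, the new vertices have
    levels at least [mx - 1] and so at least [my - 1], as [co_level] asks. The base of [u], of level
    below [mx - 1], is not on the walk. *)
Lemma core_extend x K y mx my z : core x K y mx my -> g x != g y -> my <= mx ->
  M (g x) z -> exists (u : V) (K' : seq V) (mu : nat),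
    [/\ core u K' y mu my, mu < mx & K' <> [::]].
Proof.
move=> co gxy lemy Mxz; have Mzx : M z (g x) by rewrite mate_sym.
have [rx [a [m [apx lrx ox [lva lvm] [aE alx outx]]]]] := otype_path (co_ox co).
have [lvmx leT] := co_mx co; move: lvm; rewrite lvmx => -[?]; subst m.
have gz : g z = z.
  apply/eqP/negPn/negP => gz; have [_] := gr_mate Hg Mzx gz.
  by rewrite (gr_idem Hg) eqxx.
have [k [lvk kE]] : exists k : nat, lv true z = Some k /\ mx = k.+1.
  by move: lvmx; rewrite (lv_matched Mzx); case: (lv true z) => [k|] // [<-]; exists k.
have inz : ~~ outer e M z.
  apply/negP => oz; have [j lvj ltj] := outerP oz; have := ltj _ lvk.
  have [mx' lvmx' ltx] := outerP outx; move: lvmx' lvj; rewrite lvmx (lv_matched Mxz) => -[?].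
  by subst mx'; case lvc: (lv true (g x)) => [c|] // [<-]; have := ltx _ lvc; lia_nat.
have [|u [m [euz Muz kmE lvm ou]]] := inner_pred inz lvk; first by lia_nat.
have [ru [m' [mu [_ _ _ [lvm' lvmu] [mE _ outu]]]]] := otype_path ou.
move: lvm'; rewrite lvm => -[?]; subst m'.
have lvl w o (n : nat) : g w = g x -> lv o w = Some n -> mx <= n.
  case: (eqVneq (g w) w) => [gw|gw] gwx lvn; last first.
    by apply: (class_level _ lvn gw); rewrite gwx.
  have [mx' lvmx' ltx] := outerP outx; move: lvmx' lvn; rewrite -gw gwx lvmx => -[mxE].
  by case: o => [/ltx/ltnW|]; [rewrite mxE|rewrite lvmx => -[<-]].
have gin w : w \in g x :: rx -> g w = g x.
  by case/predU1P => [->|/(allP alx)/eqP//]; apply: gr_idem Hg _.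
have zN : z \notin g x :: rx.
  apply/negP => zin; have := gin _ zin; rewrite gz => zx.
  by move: (matchingW Mxz); rewrite zx edge_irr.
have zK : z \notin K by apply: contra (co_x co) => zin; apply: core_mate co zin Mzx.
have [_ unx] := andP apx; have [altx _] := andP apx.
exists u, (z :: (g x :: rx) ++ K), mu; split=> //; last by lia_nat.
have outy : outer e M (g y).
  by have [? [? [? [_ _ _ _ []]]]] := otype_path (co_oy co).
split.
- rewrite /= euz Muz (matchingW Mzx) Mzx /= rcons_cat alts_cat altx lrx ox /=.
  exact: co_alts co.
- by rewrite /= size_cat oddD ox (co_even co).
- rewrite cons_uniq mem_cat negb_or zN zK cat_uniq unx (co_uniq co) !andTb andbT.
  apply/hasPn => w wK; apply: contra (co_x co) => win.
  by rewrite -(gin _ win); apply: co_closed co _ wK.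
- move=> w; rewrite inE mem_cat => /predU1P[->|]; first by rewrite gz mem_head.
  case/orP => [/gin ->|/(co_closed co) wK]; first by rewrite !inE eqxx orbT.
  by rewrite inE mem_cat wK !orbT.
- rewrite in_cons mem_cat; apply/norP; split; last (apply/norP; split).
  + by apply: contraNneq inz => <-.
  + apply/negP => /gin; rewrite (gr_idem Hg) => gux.
    by move: lvmu; rewrite gux lvmx => -[]; lia_nat.
  + by apply/negP => /(co_level co)/(_ lvmu)[]; lia_nat.
- rewrite in_cons mem_cat (negPf (co_y co)) orbF; apply/norP; split.
  + by apply: contraNneq inz => <-.
  + by apply: contra gxy => /gin; rewrite (gr_idem Hg) => ->.
- by [].
- exact: co_oy co.
- have [a' [c [+ lvc sz]]] := co_size co; rewrite lva => -[?]; subst a'.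
  by exists m, c; split=> //; rewrite /= size_cat /=; lia_nat.
- by split=> //; lia_nat.
- exact: co_my co.
move=> w o n; rewrite inE mem_cat => /predU1P[->|].
  case: o => lvn; first by move: lvn; rewrite lvk => -[<-]; lia_nat.
  by have [k'] := innerP inz lvn; rewrite lvk => -[<-] ?; lia_nat.
case/orP => [/gin gw lvn|wK lvn]; first by have := lvl _ _ _ gw lvn; lia_nat.
by have [] := co_level co wK lvn; lia_nat.
Qed.

(** Each extension lowers [mx + my]. As the farther side is the one to advance, it can be stuck at
    an unmatched base only if both bases have level 0, which [core_no_roots] excludes. *)
Lemma core_close x K y mx my : core x K y mx my -> (K <> [::]) \/ g x != g y ->
  exists x' K' y' mx' my', [/\ core x' K' y' mx' my', g x' = g y' & K' <> [::]].
Proof.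
have [n] := ubnP (mx + my); elim: n x K y mx my => // n IH x K y mx my le co nt.
case: (eqVneq (g x) (g y)) => [gxy|gxy].
  by exists x, K, y, mx, my; split=> //; case: nt => //; rewrite gxy eqxx.
have step x1 K1 y1 m1 n1 : core x1 K1 y1 m1 n1 -> g x1 != g y1 -> n1 <= m1 ->
    m1 + n1 <= n -> exists x' K' y' mx' my', [/\ core x' K' y' mx' my', g x' = g y' & K' <> [::]].
  move=> co1 gxy1 le1 len; case: (boolP (unmatched M (g x1))) => [ux|].
    have [lvx _] := co_mx co1; move: lvx; rewrite (unmatched_even ux) => -[m0].
    have n0 : n1 = 0 by lia_nat.
    have [lvy _] := co_my co1; rewrite n0 in lvy.
    by case: (core_no_roots co1 gxy1 ux (even0_unmatched lvy)).
  rewrite negb_forall => /existsP[z]; rewrite negbK => Mz.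
  have [u [K' [mu [co' ltmu K'N]]]] := core_extend co1 gxy1 le1 Mz.
  by apply: IH co' _; [lia_nat|left].
case: (leqP my mx) => lexy; first by apply: step co gxy lexy _; lia_nat.
by apply: step (core_sym co) _ _ _; rewrite 1?eq_sym //; lia_nat.
Qed.

Lemma core_arm x K1 d K2 y mx my (a : nat) : core x (K1 ++ d :: K2) y mx my ->
  lv false x = Some a ->
  exists r : seq V, [/\ apath (g x) r, last (g x) r = d, size r + mx = a + size K1 + 1
    & forall w, w \in r -> g w = g x \/ w \in K1 ++ d :: K2].
Proof.
move=> co lva.
have [rx [a' [m [apx lrx ox [lva' lvm] [aE alx _]]]]] := otype_path (co_ox co).
move: lva'; rewrite lva => -[?]; subst a'.
have [lvmx leT] := co_mx co; move: lvm; rewrite lvmx => -[?]; subst m.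
have [altx unx] := andP apx; exists (rx ++ rcons K1 d); split.
- apply/andP; split.
    have := co_alts co; rewrite -cat_rcons rcons_cat !alts_cat altx lrx ox /=.
    by case/andP.
  have := co_uniq co; rewrite -cat_rcons cat_uniq => /and3P[un1 _ _].
  rewrite -cat_cons cat_uniq unx un1 andbT; apply/hasPn => w wK.
  apply/negP => wx; have gw : g w = g x.
    case/predU1P: wx => [->|/(allP alx)/eqP//]; exact: gr_idem Hg x.
  have := co_x co; rewrite -gw => /negP; apply; apply: (co_closed co).
  by rewrite -cat_rcons mem_cat wK.
- by rewrite last_cat last_rcons.
- by rewrite size_cat size_rcons; lia_nat.
move=> w; rewrite mem_cat => /orP[/(allP alx)/eqP|win]; first by left.
by right; rewrite -cat_rcons mem_cat win.
Qed.

(** This is the purpose of [co_level]. Other members of the class of [g x] have levels at least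
    [mx], too large for a vertex of [q] before its end. A vertex of [K] has level at least [mx - 1],
    so on [q] it could only be the last but one, the mate of [g x]; but [K] is closed under mates
    and avoids [g x]. *)
Lemma core_root_arm x K y mx my f q r : core x K y mx my -> unmatched M f ->
  apath f q -> last f q = g x -> size q = mx -> apath (g x) r ->
  (forall w, w \in r -> g w = g x \/ w \in K) -> apath f (q ++ r).
Proof.
move=> co uf apq lq sq /andP[altr unr] rK; have [altq unq] := andP apq.
have [lvmx _] := co_mx co; have omx := lv_odd lvmx.
rewrite /apath alts_cat altq sq omx lq altr -cat_cons cat_uniq unq.
move: unr; rewrite cons_uniq => /andP[gxr ->]; rewrite !andTb andbT.
apply/hasPn => w wr; apply/negP => wq.
have wx : w != g x by apply: contraNneq gxr => <-.
have [q1 [q2 [qE l1]]] := splitPlast wq.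
rewrite qE in apq; have [n lvn len] := lv_le uf (apath_cat apq); rewrite l1 in lvn.
case: q2 qE apq => [|z q2] qE apq.
  by move: lq; rewrite qE cats0 l1 => /eqP; rewrite (negPf wx).
have sz : size q1 + (size q2).+1 = mx by rewrite -sq qE size_cat.
case: (rK _ wr) => [gw|wK].
  have : mx <= n by apply: (class_level _ lvn); rewrite gw // eq_sym.
  by lia_nat.
have [lemx _] := co_level co wK lvn.
have o1 : odd (size q1) by lia_nat.
have q20 : q2 = [::] by apply: size0nil; lia_nat.
have zE : z = g x by rewrite -lq qE q20 last_cat.
move: altq; rewrite qE alts_cat l1 o1 /= => /and4P[_ _ /eqP Mwz _].
rewrite zE in Mwz; have := core_mate co wK Mwz.
by apply/negP; apply: co_x co.
Qed.

(** The two directions around the walk reach [d] in opposite parities, with lengths from an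
    unmatched vertex adding up to [2T + 1]. The tenacity of [d] is at least that, since [d] is not
    contracted at stage [T], so both paths are shortest. *)
Lemma core_levels x K y mx my d : core x K y mx my -> g x = g y -> d \in K -> g d = d ->
  small T.+1 d /\ forall o, exists (r : seq V) (n : nat),
    [/\ apath (g x) r, last (g x) r = d, odd (size r) = o,
        lv o d = Some n & n = mx + size r /\
        forall w, w \in r -> g w = g x \/ w \in K].
Proof.
move=> co gxy dK gd; have [K1 [K2 KE]] : exists K1 K2 : seq V, K = K1 ++ d :: K2.
  by case/splitPr: dK => K1 K2; exists K1, K2.
have [a [c [lva lvc sz]]] := co_size co.
have co' := core_sym co; have [lvmx _] := co_mx co; have [lvmy _] := co_my co.
have myE : my = mx by move: lvmy; rewrite -gxy lvmx => -[].
rewrite {}KE in co co' sz *; have [r1 [ap1 l1 s1 m1]] := core_arm co lva.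
move: (co'); rewrite rev_cat rev_cons -cats1 -catA /= => co''.
have [r2 [ap2 l2 s2 m2]] := core_arm co'' lvc.
have [f [q [uf apq lq sq omx]]] := lv_path lvmx.
have app1 := core_root_arm co uf apq lq sq ap1 m1.
have lq' : last f q = g y by rewrite lq.
have sq' : size q = my by rewrite sq.
have app2 := core_root_arm co'' uf apq lq' sq' ap2 m2.
have [n1 lv1 le1] := lv_le uf app1; have [n2 lv2 le2] := lv_le uf app2.
move: lv1 lv2 le1 le2; rewrite !size_cat !last_cat lq l1 gxy l2 sq !oddD omx /=.
move: s2 sz; rewrite size_rev size_cat /= myE => s2 sz lv1 lv2 le1 le2.
have oo : odd (size r2) = ~~ odd (size r1) by lia_nat.
rewrite oo in lv2.
have fd : b T d = d by apply: (gr_fix Hg).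
have ge : T.*2 <= n1 + n2.
  have : ~~ small T d by rewrite -(cl_smallE Hb _ (leqnn T)) fd eqxx.
  by case: (odd (size r1)) lv1 lv2 => lv1 lv2;
    [rewrite (smallE T lv2 lv1)|rewrite (smallE T lv1 lv2)]; lia_nat.
have [on1 on2] := (lv_odd lv1, lv_odd lv2).
have nE : n1 + n2 = T.*2.+1 by lia_nat.
split.
  by case: (odd (size r1)) lv1 lv2 => lv1 lv2;
    [rewrite (smallE _ lv2 lv1)|rewrite (smallE _ lv1 lv2)]; lia_nat.
move=> o; case: (eqVneq (odd (size r1)) o) => [oE|oE].
  by rewrite -oE -gxy; exists r1, n1; split=> //; split=> //; lia_nat.
have {}oE : ~~ odd (size r1) = o by case: (odd _) o oE => -[].
exists r2, n2; split=> //; rewrite -?oE //; split; first by lia_nat.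
move=> w /m2[->|win]; [by left|right].
by move: win; rewrite -mem_rev rev_cat rev_cons !revK -cats1 -catA.
Qed.

Definition absorb (K : seq V) (c v : V) : V := if g v \in K then c else g v.

Lemma core_absorb x K y mx my : core x K y mx my -> g x = g y -> K <> [::] ->
  growing T b (absorb K (g x)) /\
  #|[pred v | absorb K (g x) v == v]| < #|[pred v | g v == v]|.
Proof.
move=> co gxy KN; have cK := co_x co; set c := g x in cK *.
have gc : g c = c by apply: gr_idem Hg _.
have outc : outer e M c by have [? [? [? [_ _ _ _ []]]]] := otype_path (co_ox co).
have fixg v : absorb K c v = v -> g v = v.
  by rewrite /absorb; case: ifP => // gK cv; move: gK; rewrite -cv gc (negPf cK).
have inK v : v \in K -> absorb K c v = c.
  by move=> vK; rewrite /absorb (co_closed co vK).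
have inc v : g v = c -> absorb K c v = c by rewrite /absorb => ->; case: ifP.
have sm v : g v = v -> v \in K -> small T.+1 v.
  by move=> gv vK; have [] := core_levels co gxy vK gv.
split; last first.
  apply: proper_card; apply/properP; split.
    by apply/subsetP => v; rewrite !inE => /eqP/fixg/eqP.
  case: (K) KN co => [//|w K'] _ co'; exists (g w).
    by rewrite inE (gr_idem Hg).
  rewrite inE /absorb (gr_idem Hg) (co_closed co' (mem_head _ _)).
  apply: contraNneq (co_x co') => cw; rewrite -/c cw.
  by apply: (co_closed co'); apply: mem_head.
split.
- move=> v; case: (boolP (g v \in K)) => gvK.
    have -> : absorb K c v = c by rewrite /absorb gvK.
    exact: inc.
  have -> : absorb K c v = g v by rewrite /absorb (negPf gvK).
  by rewrite /absorb (gr_idem Hg) (negPf gvK).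
- by move=> v; rewrite /absorb (gr_coarse Hg).
- by move=> v /fixg; apply: gr_fix Hg _.
- move=> v av; case: (eqVneq (g v) v) => [gv|]; last by apply: (gr_small Hg).
  by apply: sm => //; apply: contraR av => vK; rewrite /absorb gv (negPf vK).
- move=> v w Mvw av; case: (eqVneq (g v) v) => [gv|gv].
    have vK : v \in K by apply: contraR av => vK; rewrite /absorb gv (negPf vK).
    have wK := core_mate co vK Mvw; rewrite !inK //; split=> //.
    by apply: contraNneq cK => ->.
  have [gw gwN] := gr_mate Hg Mvw gv; rewrite /absorb gw; split=> //.
  case: ifP => [gvK|_]; last by rewrite -gw.
  by apply: contraTneq gvK => cw; rewrite -gw -cw gc.
- by move=> v; rewrite /absorb; case: ifP => // _ /(gr_outer Hg).
move=> v o av; case: (boolP (g v \in K)) => gvK; last first.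
  have avE : absorb K c v = g v by rewrite /absorb (negPf gvK).
  rewrite avE in av *; have [r [n [m [ap lr od lvs [nE al]]]]] := gr_path Hg o av.
  exists r, n, m; split=> //; split=> //; apply: sub_all al => w /eqP gw.
  by rewrite /absorb gw (negPf gvK).
have avE : absorb K c v = c by rewrite /absorb gvK.
rewrite avE; have [lvmx leT] := co_mx co.
case: (eqVneq (g v) v) => [gv|gv].
  rewrite gv in gvK; have [_ /(_ o)[r [n [ap lr od lvn [nE rK]]]]] := core_levels co gxy gvK gv.
  exists r, n, mx; split=> //; split=> //; apply/allP => w /rK[/inc ->//|/inK ->//].
have [_ /(_ false)[r [n [ap lr od lvn [nE rK]]]]] := core_levels co gxy gvK (gr_idem Hg v).
have [r' [n' [m' [ap' lr' od' [lvn' lvm'] [nE' al']]]]] := gr_path Hg o gv.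
move: lvm'; rewrite lvn => -[?]; subst m'.
(* The even path to the old base of [v] is continued inside the old class. The parts are disjoint: a
   member of that class met earlier on [r] would have a level below that of its base, against
   [class_level]. *)
exists (r ++ r'), n', mx; split.
- have [alt un] := andP ap; have [alt' un'] := andP ap'.
  rewrite /apath alts_cat alt lr od alt' -cat_cons cat_uniq un !andTb.
  move: (un'); rewrite cons_uniq => /andP[_ ->]; rewrite andbT.
  apply/hasPn => w wr'; apply/negP => wr.
  have gw : g w = g v by apply/eqP; apply: (allP al').
  have gwN : g w != w.
    by rewrite gw; apply: contraTneq un' => gvw; rewrite cons_uniq gvw wr'.
  have [r1 [r2 [rE l1]]] := splitPlast wr.
  have [f [q [uf apq lq sq _]]] := lv_path lvmx.
  have apf := core_root_arm co uf apq lq sq ap rK.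
  rewrite rE catA in apf; have [k lvk lek] := lv_le uf (apath_cat apf).
  rewrite last_cat lq l1 in lvk; rewrite size_cat sq in lek.
  have := class_level _ lvk gwN; rewrite gw => /(_ _ lvn).
  case: r2 rE {apf} => [|z r2] rE.
    by move: lr; rewrite rE cats0 l1 => wE; rewrite gw wE eqxx in gwN.
  by move: nE; rewrite rE size_cat /=; lia_nat.
- by rewrite last_cat lr.
- by rewrite size_cat oddD od.
- by [].
rewrite size_cat; split; first by lia_nat.
rewrite all_cat; apply/andP; split; apply/allP => w.
  by move=> /rK[/inc ->|/inK ->].
by move/(allP al')/eqP => gw; rewrite /absorb gw gvK.
Qed.

End Core.

(** These are [cl_unmatched] and [cl_matched] at stage [T + 1], the two fields that [growing] does
    not provide. *)
Definition closed (g : V -> V) : Prop :=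
  (forall x y (a c : nat), e x y -> M x y = false -> otype g x -> otype g y ->
     lv false x = Some a -> lv false y = Some c -> a + c + 1 < T.+1.*2 -> g x = g y) /\
  (forall x y (k : nat), M x y -> ~~ otype g x -> ~~ otype g y -> lv true x = Some k ->
     T.+1 <= k).

Lemma core_edge g x y (a c : nat) : growing T b g -> e x y -> M x y = false ->
  otype g x -> otype g y -> lv false x = Some a -> lv false y = Some c ->
  a + c + 1 < T.+1.*2 -> g x != g y -> exists mx my, core g x [::] y mx my.
Proof.
move=> Hg exy Mxy ox oy lva lvc lt gxy.
have [rx [a' [mx [_ _ _ [lva' lvx] [aE _ _]]]]] := otype_path Hg ox.
have [ry [c' [my [_ _ _ [lvc' lvy] [cE _ _]]]]] := otype_path Hg oy.
move: lva' lvc'; rewrite lva lvc => -[?] [?]; subst a' c'.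
have bxy : b T x != b T y.
  by apply: contra gxy => /eqP bxy; rewrite -(gr_coarse Hg x) bxy (gr_coarse Hg).
have eyx : e y x by rewrite edge_sym.
have Myx : M y x = false by rewrite mate_sym.
have [oa oc] := (lv_odd lva, lv_odd lvc).
have small_inner u v (i j : nat) : e u v -> M u v = false -> ~~ outer e M u ->
    lv false u = Some i -> lv false v = Some j -> i + j + 1 < T.*2 -> b T u != u.
  move=> euv Muv inu lvi lvj ltij; rewrite (cl_smallE Hb _ (leqnn T)).
  have [k lvk lek] := inner_edge euv Muv inu lvi lvj.
  by rewrite (smallE T lvi lvk); lia_nat.
(* For a smaller sum, [cl_unmatched] at stage [T] would already give both ends the same base. *)
have sz : a + c = T.*2.
  apply/eqP; rewrite eqn_leq; apply/andP; split; first by lia_nat.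
  rewrite leqNgt; apply: contra bxy => ltT; apply/eqP.
  apply: (cl_unmatched Hb (leqnn T) exy Mxy _ _ lva lvc); last by lia_nat.
    rewrite /otype; case: (boolP (outer e M x)) => //= inx.
    by apply: small_inner exy Mxy inx lva lvc _; lia_nat.
  rewrite /otype; case: (boolP (outer e M y)) => //= iny.
  by apply: small_inner eyx Myx iny lvc lva _; lia_nat.
have leT u v (i j m : nat) : e u v -> M u v = false -> otype g u -> lv false u = Some i ->
    lv false v = Some j -> i + j = T.*2 -> lv false (g u) = Some m -> m <= T.
  move=> euv Muv ou lvi lvj ij lvm; case: (eqVneq (g u) u) => gu; last exact: base_le_T lvm gu.
  move: ou lvm; rewrite /otype gu eqxx orbF lvi => /outerP[i' + lti] [<-].
  rewrite lvi => -[?]; subst i'; have evu : e v u by rewrite edge_sym.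
  have Mvu : M v u = false by rewrite mate_sym.
  case: (lv_edge evu Mvu lvj) => -[n lvn]; first by have := lti _ lvn; lia_nat.
  by move: lvn; rewrite lvi => -[<-]; lia_nat.
exists mx, my; split=> //=; rewrite ?exy ?Mxy //.
- by exists a, c; split; rewrite ?add0n.
- by split=> //; apply: leT exy Mxy ox lva lvc sz lvx.
- by split=> //; apply: leT eyx Myx oy lvc lva _ lvy; lia_nat.
Qed.

(** Both ends have oddlevel [T]: their oddlevels agree, and a smaller value would make them
    contracted. The bridge is the edge inside [K], and the ends of the walk are predecessors of [x]
    and [y]. *)
Lemma core_matched g x y (k : nat) : growing T b g -> M x y ->
  ~~ otype g x -> ~~ otype g y -> lv true x = Some k -> k < T.+1 ->
  exists u v mu mv, core g u [:: x; y] v mu mv.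
Proof.
move=> Hg Mxy; have Myx : M y x by rewrite mate_sym.
have otN z : ~~ otype g z -> ~~ outer e M z /\ g z = z.
  by case/norP => inz /negPn/eqP gz.
move=> /otN[inx gx] /otN[iny gy] lvk ltk {otN}.
have lvky : lv false y = Some k.+1 by rewrite (lv_matched Mxy) lvk.
have [k' lvk' ltk'] := innerP iny lvky.
have lvkx : lv false x = Some k'.+1 by rewrite (lv_matched Myx) lvk'.
have [k'' + ltk''] := innerP inx lvkx; rewrite lvk => -[?]; subst k''.
have kE : k' = k by have := lv_odd lvk; have := lv_odd lvk'; lia_nat.
rewrite {}kE {ltk' ltk''} in lvk' lvkx.
have kT : k = T.
  have : ~~ small T x by rewrite -(cl_smallE Hb _ (leqnn T)) (gr_fix Hg gx) eqxx.
  by rewrite (smallE T lvkx lvk); lia_nat.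
have [|u [m [eux Mux kmE lvm ou]]] := inner_pred Hg inx lvk; first by lia_nat.
have [|v [n [evy Mvy knE lvn ov]]] := inner_pred Hg iny lvk'; first by lia_nat.
have [ru [a' [mu [_ _ _ [lva' lvu] [aE _ outu]]]]] := otype_path Hg ou.
have [rv [c' [mv [_ _ _ [lvc' lvv] [cE _ outv]]]]] := otype_path Hg ov.
move: lva' lvc'; rewrite lvm lvn => -[?] [?]; subst a' c'.
have inN w : outer e M w -> w \notin [:: x; y].
  move=> ow; rewrite !inE negb_or; apply/andP; split.
    by apply: contraNneq inx => <-.
  by apply: contraNneq iny => <-.
have lvl w o (i : nat) : w \in [:: x; y] -> lv o w = Some i -> T <= i.
  rewrite !inE => /orP[]/eqP->; case: o; rewrite ?lvkx ?lvky ?lvk ?lvk' => -[<-]; lia_nat.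
exists u, v, mu, mv; split=> //.
- by rewrite /= eux Mux (matchingW Mxy) Mxy edge_sym evy mate_sym Mvy.
- rewrite /= inE andbT; apply: contraTneq (matchingW Mxy) => ->; by rewrite edge_irr.
- by move=> w; rewrite !inE => /orP[]/eqP->; rewrite ?gx ?gy eqxx ?orbT.
- exact: inN.
- exact: inN.
- by exists m, n; split=> //=; lia_nat.
- by split=> //; lia_nat.
- by split=> //; lia_nat.
by move=> w o i win lvi; have := lvl _ _ _ win lvi; lia_nat.
Qed.

Lemma growing_closed g : growing T b g -> exists2 g', growing T b g' & closed g'.
Proof.
have [n] := ubnP #|[pred v | g v == v]|; elim: n g => // n IH g ltn Hg.
have step x K y mx my : core g x K y mx my -> K <> [::] \/ g x != g y ->
    exists2 g', growing T b g' & closed g'.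
  move=> co nt; have [x' [K' [y' [mx' [my' [co' gxy KN]]]]]] := core_close Hg co nt.
  have [Hg' ltf] := core_absorb Hg co' gxy KN.
  by apply: (IH _ _ Hg'); apply: leq_trans ltf _.
pose cross1 (xy : V * V) := if lv false xy.1 is Some a then
    if lv false xy.2 is Some c then
      [&& e xy.1 xy.2, ~~ M xy.1 xy.2, otype g xy.1, otype g xy.2, a + c + 1 < T.+1.*2
        & g xy.1 != g xy.2] else false else false.
pose cross2 (xy : V * V) := if lv true xy.1 is Some k then
  [&& M xy.1 xy.2, ~~ otype g xy.1, ~~ otype g xy.2 & k < T.+1] else false.
case: (pickP cross1) => [[x y]|N1].
  rewrite /cross1 /=; case lva: (lv false x) => [a|] //; case lvc: (lv false y) => [c|] //.
  case/and5P => exy /negbTE Mxy ox oy /andP[lt gxy].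
  have [mx [my co]] := core_edge Hg exy Mxy ox oy lva lvc lt gxy.
  by apply: step co _; right.
case: (pickP cross2) => [[x y]|N2].
  rewrite /cross2 /=; case lvk: (lv true x) => [k|] // /and4P[Mxy ox oy lt].
  have [u [v [mu [mv co]]]] := core_matched Hg Mxy ox oy lvk lt.
  by apply: step co _; left.
exists g => //; split=> [x y a c exy Mxy ox oy lva lvc lt|x y k Mxy ox oy lvk].
  have := N1 (x, y); rewrite /cross1 /= lva lvc exy Mxy ox oy lt /=.
  by move/negbFE/eqP.
have := N2 (x, y); rewrite /cross2 /= lvk Mxy ox oy /=.
by move/negbT; rewrite -leqNgt.
Qed.

Lemma classes_extend : exists b', classes T.+1 b'.
Proof.
have [g Hg [cl1 cl2]] := growing_closed (growing_init Hb).
exists (fun s => if s <= T then b s else g).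
have top s : s <= T.+1 -> T < s -> s = T.+1 by lia_nat.
split.
- move=> s s' v ss' s'T; case: (leqP s' T) => s'T'.
    by rewrite (leq_trans ss' s'T'); apply: (cl_mono Hb).
  case: (leqP s T) => sT; last by apply: gr_idem Hg _.
  by rewrite -(gr_coarse Hg (b s v)) (cl_mono Hb v sT (leqnn T)) (gr_coarse Hg).
- move=> s s' v ss' s'T; case: (leqP s' T) => s'T'.
    by rewrite (leq_trans ss' s'T'); apply: (cl_fix Hb).
  case: (leqP s T) => sT // gv.
  by apply: (cl_fix Hb sT (leqnn T)); apply: (gr_fix Hg).
- move=> s f sT uf; case: (leqP s T) => sT'; first exact: (cl_root Hb).
  apply/eqP; apply: contraNT (root_not_small Hlm uf); exact: gr_small Hg _.
- move=> s v sT; case: (leqP s T) => sT'; first exact: (cl_small Hb).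
  by rewrite (top s sT sT'); apply: gr_small Hg _.
- move=> s v w sT; case: (leqP s T) => sT'; first exact: (cl_mate Hb).
  exact: gr_mate Hg _ _.
- move=> s v sT; case: (leqP s T) => sT'; first exact: (cl_outer Hb).
  exact: gr_outer Hg _.
- move=> s x y a c sT; case: (leqP s T) => sT'; first exact: (cl_unmatched Hb).
  by rewrite (top s sT sT'); apply: cl1.
- move=> s x y k sT; case: (leqP s T) => sT'; first exact: (cl_matched Hb).
  by rewrite (top s sT sT'); apply: cl2.
Qed.

End Grow.

Lemma classes_exist T : (forall s, s < T -> below_l_m s.*2.+1) -> exists b, classes T b.
Proof.
elim: T => [|T IH] Hlm.
  exists (fun _ v => v); split=> //.
  - by move=> s v; rewrite eqxx.
  - by move=> s v w; rewrite eqxx.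
  - by move=> s v; rewrite eqxx.
  - by move=> s x y a c; rewrite leqn0 => /eqP->.
  - by move=> s x y k; rewrite leqn0 => /eqP->.
have [|b Hb] := IH; first by move=> s sT; apply: Hlm; lia_nat.
by apply: classes_extend Hb _; apply: Hlm.
Qed.

(** * Props, bridges and the uniqueness of the bridge *)

Lemma minlevel_outer v : outer e M v -> minlevel e M v = lv false v.
Proof.
rewrite /outer /minlevel /emin /elt /evenlevel /oddlevel.
case: (lv false v) => [a|]; case: (lv true v) => [c|] //=.
by rewrite -ltnNge => /ltnW ->.
Qed.

Lemma minlevel_inner v : ~~ outer e M v -> minlevel e M v = lv true v.
Proof.
rewrite /outer /minlevel /emin /elt negbK /evenlevel /oddlevel.
case: (lv false v) => [a|]; case: (lv true v) => [c|] //=.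
by move=> le; case: (leqP a c) => // le'; congr Some; apply/eqP; rewrite eqn_leq le'.
Qed.

Lemma prop_edgeC x y : prop_edge e M x y -> prop_edge e M y x.
Proof. by case=> p []; exists p; [right|left]. Qed.

(** The evenlevel path to [x] has length [c], below both levels of [y], so it avoids [y] and extends
    to a minlevel path. *)
Lemma prop_unmatched x y (c : nat) : e x y -> M x y = false -> ~~ outer e M y ->
  lv true y = Some c.+1 -> lv false x = Some c -> prop_edge e M x y.
Proof.
move=> exy Mxy iny lvy /[dup] lvx /lv_path[f [s [uf ap ls sz oc]]].
have yN : y \notin f :: s.
  apply/negP => yin; have [s1 [s2 [sE l1]]] := splitPlast yin.
  have le1 : size s1 <= c by rewrite -sz sE size_cat leq_addr.
  rewrite sE in ap; have [m] := lv_le uf (apath_cat ap); rewrite l1.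
  case: (odd (size s1)); first by rewrite lvy => -[<-]; lia.
  by move=> /(innerP iny)[j]; rewrite lvy => -[<-]; lia.
have ap' : apath f (rcons s y).
  move: ap; rewrite /apath alts_rcons ls exy sz oc Mxy -rcons_cons rcons_uniq yN.
  by rewrite !andbT.
exists (f :: rcons s y); left; split; last first.
  by exists (belast f s); rewrite -ls -lastI.
rewrite /minlevel_path (minlevel_inner iny) lvy /plen /= size_rcons sz eqxx andbT.
apply/orP; right; apply/level_pathP; exists f, (rcons s y).
by rewrite last_rcons size_rcons sz.
Qed.

Lemma prop_matched x y : M x y -> outer e M x -> prop_edge e M x y.
Proof.
move=> Mxy ox; have [a lva _] := outerP ox.
have [f [s [uf ap ls sz oa]]] := lv_path lva.
exists (f :: s); right; split.
  rewrite /minlevel_path (minlevel_outer ox) lva /plen /= sz eqxx andbT.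
  by apply/orP; left; apply/level_pathP; exists f, s; rewrite sz.
case: (lastP s) ap ls sz => [_ /= fx|s' z] ap.
  by have := unmatchedF y uf; rewrite fx Mxy.
rewrite last_rcons size_rcons => zE sz; rewrite {}zE in ap *.
move: ap; rewrite /apath alts_rcons => /andP[/and3P[_ _ /eqP Mx] _].
have yE : last f s' = y.
  by apply: (@mate_uniql _ _ x) => //; rewrite 1?[M y x]mate_sym // Mx; move: oa; rewrite -sz /= => /negbFE.
by exists (belast f s'); rewrite -yE -lastI.
Qed.

Lemma minlevel_last x y p : minlevel_path e M y p -> last_edge x y p ->
  exists f s, [/\ unmatched M f, apath f (rcons s y), last f s = x,
    minlevel e M y = Some (size s).+1 & lv (~~ odd (size s)) y = Some (size s).+1].
Proof.
case/andP => eo /eqP mp [q pE].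
have [o /level_pathP[f [s [pE' uf ap ls lvs]]]] : exists o, level_path e M o y p.
  by case/orP: eo; [exists false|exists true].
move: pE; rewrite pE' => pE; case: (lastP s) pE pE' ap ls lvs => [|s' z].
  by move/(congr1 size); rewrite !size_rcons.
rewrite -rcons_cons => /rcons_inj[sE zE] pE'; rewrite {}zE => ap ls lvs.
have lx : last f s' = x by have := congr1 (last x) sE; rewrite last_rcons.
exists f, s'; rewrite size_rcons in lvs.
split=> //; first by rewrite -mp pE' /plen /= size_rcons.
by have := lv_odd lvs; rewrite /= => ->.
Qed.

Lemma not_prop_inner x y : M x y -> ~~ outer e M x -> ~~ outer e M y ->
  ~ prop_edge e M x y.
Proof.
suff half u v : M u v -> ~~ outer e M v ->
    forall p, minlevel_path e M v p -> last_edge u v p -> False.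
  move=> Mxy inx iny [p [[mp lp]|[mp lp]]]; first exact: half Mxy iny p mp lp.
  by apply: half inx p mp lp; rewrite mate_sym.
move=> Muv inv p mp lp; have [f [s [uf ap ls mE lvv]]] := minlevel_last mp lp.
have := mE; rewrite (minlevel_inner inv) => /lv_odd /= os.
move: ap; rewrite /apath alts_rcons ls Muv => /andP[/and3P[_ _ /eqP Mo] _].
by move: os Mo; case: odd.
Qed.

(** If a minlevel path to [v] ended with the edge [uv], then [v] would be inner and hence
    contracted, with tenacity below [2T]. But its oddlevel would exceed [i], and its tenacity
    [i + j = 2T]. *)
Lemma not_prop_unmatched T b x y (a c : nat) : classes T b -> e x y -> M x y = false ->
  otype (b T) x -> otype (b T) y -> lv false x = Some a -> lv false y = Some c ->
  a + c = T.*2 -> ~ prop_edge e M x y.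
Proof.
move=> Hb exy Mxy ox oy lva lvc ac.
suff half u v (i j : nat) : M u v = false -> otype (b T) v ->
    lv false u = Some i -> lv false v = Some j -> i + j = T.*2 ->
    forall p, minlevel_path e M v p -> last_edge u v p -> False.
  move=> [p [[mp lp]|[mp lp]]]; first exact: half Mxy oy lva lvc ac p mp lp.
  by apply: half ox lvc lva _ p mp lp; rewrite 1?mate_sym // addnC.
move=> Muv ov lvi lvj ij p mp lp; have [f [s [uf ap ls mE lvv]]] := minlevel_last mp lp.
have os : odd (size s) = false.
  by move: ap; rewrite /apath alts_rcons ls Muv => /andP[/and3P[_ _ /eqP Mo] _];
    move: Mo; case: odd.
rewrite os in lvv; case: (boolP (outer e M v)) => [ov'|inv].
  by move: mE; rewrite (minlevel_outer ov') => /lv_odd /=; rewrite os.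
have bv : b T v != v by move: ov; rewrite /otype (negPf inv).
have := cl_small Hb (leqnn T) bv; rewrite (smallE T lvj lvv) => lt.
have ap' : apath f s by move: ap; rewrite -cats1; apply: apath_cat.
have [m] := lv_le uf ap'; rewrite os ls lvi => -[<-]; lia_nat.
Qed.

Lemma path_edges_rcons (x y : V) s :
  path_edges (x :: rcons s y) = rcons (path_edges (x :: s)) (last x s, y).
Proof.
rewrite /path_edges /=; elim: s x => [//|z s IH] x.
by rewrite rcons_cons [LHS]/= IH.
Qed.

Lemma path_edgesP (c x y : V) s : (x, y) \in path_edges (c :: s) ->
  exists s1 s2 : seq V, s = s1 ++ y :: s2 /\ last c s1 = x.
Proof.
elim/last_ind: s => [//|s z IH]; rewrite path_edges_rcons mem_rcons inE.
case/predU1P => [[-> ->]|/IH[s1 [s2 [-> l1]]]]; first by exists s, [::]; rewrite cats1.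
by exists s1, (rcons s2 z); rewrite rcons_cat.
Qed.

Lemma edge_tenacity_matched x y : M x y -> edge_tenacity e M x y = tenacity e M x.
Proof.
move=> Mxy; have Myx : M y x by rewrite mate_sym.
rewrite /edge_tenacity Mxy /tenacity /evenlevel /oddlevel (lv_matched Myx).
by case: (lv true x) => [i|]; case: (lv true y) => [j|] //=; congr Some; lia.
Qed.

Lemma edge_tenacity_unmatched x y (a c : nat) : M x y = false ->
  lv false x = Some a -> lv false y = Some c -> edge_tenacity e M x y = Some (a + c + 1).
Proof. by rewrite /edge_tenacity /evenlevel => -> -> ->. Qed.

Section UniqueBridge.
Context (T : nat) (b : nat -> V -> V) (Hb : classes T b).

Definition big_bridge (x y : V) : Prop :=
  bridge e M x y /\ edge_tenacity e M x y = Some T.*2.+1.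

(* A tight path first descends away from its root and then, after one bridge
   of tenacity [2 * T + 1], ascends; a contracted class is entered through its
   base in the first phase, and left through it in the second. *)
Definition descending (f : V) (s : seq V) : bool :=
  let v := last f s in
  if b T v == v then outer e M v == ~~ odd (size s) else b T v \in f :: s.

(** For an unmatched edge, slackness leaves three cases: inside a class the tenacity is below
    [2T + 1]; between two classes of outer type the edge is a bridge and the crossing condition
    switches the phase; with an inner uncontracted end the edge is a prop. A matched edge switches
    the phase only between two inner uncontracted vertices. *)
Lemma descending_step f s y : alts false f (rcons s y) -> uniq (f :: rcons s y) ->
  tight T b f (rcons s y) ->
  (descending f (rcons s y) = descending f s /\ ~ big_bridge (last f s) y) \/
  [/\ descending f s, ~~ descending f (rcons s y) & big_bridge (last f s) y].
Proof.
move=> alt un tgt; have := alt; rewrite alts_rcons => /and3P[_].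
rewrite /descending last_rcons size_rcons /=.
have inE' : forall z, z != y -> (z \in f :: rcons s y) = (z \in f :: s).
  by move=> z zy; rewrite -rcons_cons mem_rcons in_cons (negPf zy).
have yN : y \notin f :: s by move: un; rewrite -rcons_cons rcons_uniq => /andP[].
have [x lx] : exists x, last f s = x by exists (last f s).
have xin : x \in f :: s by rewrite -lx mem_last.
have [_ st] := tgt s [:: y] (esym (cats1 _ _)); rewrite lx => exy /eqP Mxy.
case: (boolP (odd (size s))) Mxy => os /= Mxy.
  have Myx : M y x by rewrite mate_sym.
  case: (eqVneq (b T x) x) => bx; last first.
    have [byx byN] := cl_mate Hb (leqnn T) Mxy bx; rewrite (negPf byN).
    left; split; first by rewrite byx inE' // -byx.
    case=> _; rewrite edge_tenacity_matched // => tx.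
    by have := cl_small Hb (leqnn T) bx; rewrite /small tx; lia.
  have byy : b T y = y.
    apply/eqP/negPn/negP => byN.
    by have [_] := cl_mate Hb (leqnn T) Myx byN; rewrite bx eqxx.
  rewrite byy eqxx /=; case: (boolP (outer e M x)) => ox.
    have [a lva odlt] := outerP ox.
    have -> : outer e M y = false.
      apply: negbTE; apply/negP => oy; have [c lvc odlt'] := outerP oy.
      move: lva lvc; rewrite (lv_matched Mxy) (lv_matched Myx).
      case lvx: (lv true x) => [i|] //; case lvy: (lv true y) => [j|] // [aE] [cE].
      by have := odlt _ lvx; have := odlt' _ lvy; lia_nat.
    by left; split=> //; case=> -[_ np] _; apply: np; apply: prop_matched.
  case: (boolP (outer e M y)) => oy.
    by left; split=> //; case=> -[_ np] _; apply: np; apply/prop_edgeC/prop_matched.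
  right; split=> //; split; first by split=> //; apply: not_prop_inner.
  (* The tenacity is read off the preceding edge: its tightness gives [x] an oddlevel [c + 1] with
     [c < T], while [cl_matched] gives [T <= c + 1]. *)
  case/lastP: s os lx alt tgt {un inE' yN xin st exy} => [//|s z] os.
  rewrite last_rcons => zx alt tgt; rewrite {}zx in alt tgt os *.
  rewrite size_rcons /= in os.
  have sxy : rcons (rcons s x) y = s ++ [:: x; y] by rewrite -!cats1 -catA.
  have [_ st] := tgt _ _ sxy.
  have {st} [st _] : tight_step T b f s x by apply: st os.
  move: alt; rewrite !alts_rcons => /and3P[/and3P[_ ezx /eqP Mzx] _ _].
  rewrite (negPf os) /= in Mzx.
  have [] := tight_edge_cases Hb ezx Mzx st.
  - by move=> [a [c [_]]]; rewrite /otype (negPf ox) bx eqxx.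
  - by move=> [c [_]]; rewrite /otype (negPf ox) bx eqxx.
  move=> [c [_ _ lvx lvz ltc]].
  have lec : T <= c.+1.
    by apply: (cl_matched Hb (leqnn T) Mxy _ _ lvx);
      rewrite /otype ?bx ?byy eqxx orbF.
  rewrite edge_tenacity_matched // /tenacity /evenlevel /oddlevel (lv_matched Myx) lvx.
  have lvyE : lv false y = Some c.+2 by rewrite (lv_matched Mxy) lvx.
  have [j lvj ltj] := innerP oy lvyE.
  have lvxE : lv false x = Some j.+1 by rewrite (lv_matched Myx) lvj.
  have [i + lti] := innerP ox lvxE; rewrite lvx => -[iE].
  have [oj oc] := (lv_odd lvj, lv_odd lvx).
  by rewrite lvj /=; congr Some; lia_nat.
have {}st := st y [::] erefl os; case: st; rewrite lx => st /(_ T (leqnn T)) cross.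
have [] := tight_edge_cases Hb exy Mxy st.
- move=> [a [c [ox oy lva lvc sz]]].
  have xE : (b T x == x) -> outer e M x by move: ox; rewrite /otype; case: eqP; rewrite ?orbF.
  have yE : (b T y == y) -> outer e M y by move: oy; rewrite /otype; case: eqP; rewrite ?orbF.
  case: (eqVneq (b T x) (b T y)) => bxy.
    left; split; last first.
      case=> _; rewrite (edge_tenacity_unmatched Mxy lva lvc) => -[tE].
      have : 0 < common T b x y; last by lia_nat.
      by rewrite /common big_ord_recr /= bxy eqxx addn1.
    rewrite (_ : (if b T x == x then _ else _) = (b T y \in f :: s)); last first.
      case: ifP => bx; last by rewrite bxy.
      by rewrite (xE bx) -bxy (eqP bx) xin.
    case: (boolP (b T y == y)) => [by_|byN]; last by rewrite inE'.
    by rewrite (yE by_) (eqP by_) (negPf yN).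
  have /andP[bxin byN] := cross bxy; right; split.
  - by case: ifP => // bx; rewrite (xE bx).
  - case: ifP => byy; first by rewrite (yE byy).
    by rewrite inE' ?byy.
  have c0 : common T b x y = 0.
    apply/eqP; rewrite sum_nat_eq0; apply/forallP => k /=.
    have kT : k <= T by rewrite -ltnS.
    rewrite eqb0; apply: contra bxy => /eqP bk.
    by rewrite -(cl_mono Hb x kT (leqnn T)) bk (cl_mono Hb y kT (leqnn T)).
  have ac : a + c = T.*2 by lia_nat.
  split; last by rewrite (edge_tenacity_unmatched Mxy lva lvc) addn1 ac.
  by split=> //; apply: (not_prop_unmatched Hb exy Mxy ox oy lva lvc ac).
- move=> [c [/norP[inx /negPn/eqP bx] oy lvx lvy _]].
  have bxy : b T x != b T y.
    rewrite bx; case: (eqVneq (b T y) y) => [->|byN].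
      by apply: contraTneq exy => ->; rewrite edge_irr.
    by apply: contraNneq inx => ->; apply: (cl_outer Hb (leqnn T)).
  have /andP[_ byN] := cross bxy; left; split; last first.
    case=> -[_ np] _; apply: np; apply: prop_edgeC.
    by apply: prop_unmatched inx lvx lvy; rewrite 1?edge_sym 1?mate_sym.
  rewrite bx eqxx (negPf inx) /=; case: ifP => byy; last by rewrite inE' ?byy // (negPf byN).
  by move: oy; rewrite /otype byy orbF => ->.
move=> [c [/norP[iny /negPn/eqP byy] ox lvy lvx _]].
have bxy : b T x != b T y.
  rewrite byy; case: (eqVneq (b T x) x) => [->|bxN].
    by apply: contraTneq exy => ->; rewrite edge_irr.
  by apply: contraNneq iny => <-; apply: (cl_outer Hb (leqnn T)).
have /andP[bxin _] := cross bxy; left; split; last first.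
  by case=> -[_ np] _; apply: np; apply: prop_unmatched iny lvy lvx.
rewrite byy eqxx (negPf iny) /=; case: ifP => bx; last by rewrite bxin.
by move: ox; rewrite /otype bx orbF => ->.
Qed.

(** At stage [T] the vertex [v] is not contracted, and a maxlevel path reaches it in the parity that
    its type does not prefer. Thus the path begins descending and ends ascending, and the phase
    switches once. Only stage [T] is involved, so the case of tenacity [l_m] is covered. *)
Lemma unique_bridge_max v p : tenacity e M v = Some T.*2.+1 -> maxlevel_path e M v p ->
  unique_bridge e M (Some T.*2.+1) p.
Proof.
move=> tv /andP[eo /eqP mp].
have [a [c [lva lvc acE oa oc]]] := tenacityE tv.
have [o /level_pathP[f [s [pE uf ap ls lvs]]]] : exists o, level_path e M o v p.
  by case/orP: eo; [exists false|exists true].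
rewrite {}pE in mp *; move: mp; rewrite /plen /= => mp.
have smv : small T.+1 v by rewrite /small tv; lia.
have oE := lv_odd lvs; rewrite -oE in lvs.
have := @level_bound _ _ Hb _ _ (size s) ap (fun k => root_fixed Hb uf).
rewrite ls => /(_ smv lvs)[_]; rewrite (Y_root Hb uf) addn0 => /(_ (leqnn _))[tgt _].
have bv : b T v = v.
  apply/eqP/negPn/negP => /(cl_small Hb (leqnn T)); rewrite /small tv; lia.
have Dv : ~~ descending f s.
  rewrite /descending ls bv eqxx; move: mp; rewrite /maxlevel /emax /evenlevel /oddlevel.
  rewrite /outer /elt /evenlevel /oddlevel lva lvc /=.
  by case: leqP => le /= [->]; rewrite ?oa ?oc; case: leqP => //; lia.
have D0 : descending f [::].
  have := Y_root Hb uf; rewrite /Y /descending /= (root_fixed Hb uf (leqnn T)) eqxx.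
  rewrite /outer /evenlevel /oddlevel (unmatched_even uf) /elt /= => _.
  by case E: (lv true f) => [i|] //=; have := lv_odd E; case: i E.
have [alt un] := andP ap.
pose bb (xy : V * V) := big_bridge xy.1 xy.2.
suff : if descending f s then forall xy, xy \in path_edges (f :: s) -> ~ bb xy
    else exists! xy, xy \in path_edges (f :: s) /\ bb xy.
  rewrite (negPf Dv) => -[xy [[xyin [br te]] uq]]; exists xy; split=> //.
  by move=> xy' [xyin' br' te']; apply: uq.
elim/last_ind: s alt un tgt {ap ls lvs oE mp Dv} => [|s y IH] alt un tgt.
  by rewrite D0.
have alt' : alts false f s by move: alt; rewrite alts_rcons => /andP[].
have un' : uniq (f :: s) by move: un; rewrite -rcons_cons rcons_uniq => /andP[].
have tgt' : tight T b f s by move: tgt; rewrite -cats1; apply: tight_prefix.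
have {IH} := IH alt' un' tgt'; rewrite path_edges_rcons.
case: (descending_step alt un tgt) => [[-> nbb]|[D1 /negbTE D2 yes]].
  case: ifP => _ => [none xy|[xy [[xyin bxy] uq]]].
    by rewrite mem_rcons inE => /predU1P[->|/none].
  exists xy; split; first by rewrite mem_rcons inE xyin orbT.
  move=> xy' []; rewrite mem_rcons inE => /predU1P[->|xyin' bxy'] //.
  exact: uq.
rewrite D1 D2 => none; exists (last f s, y); split.
  by rewrite mem_rcons mem_head.
move=> xy' []; rewrite mem_rcons inE => /predU1P[->|xyin' bxy'] //.
by case: (none _ xyin' bxy').
Qed.

End UniqueBridge.

(** * Bases, blossoms and the claims of the theorem *)

Lemma elt_small T x : elt (Some T.*2.+1) (tenacity e M x) = ~~ small T.+1 x.
Proof.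
by rewrite /small /elt; case: (tenacity e M x) => [t|] //=; rewrite doubleS ltnS.
Qed.

Lemma ele_small T x : ele (tenacity e M x) (Some T.*2.+1) = small T.+1 x.
Proof. by rewrite -[LHS]negbK -[~~ ele _ _]/(elt _ _) elt_small negbK. Qed.

Lemma tenacity_small T x : small T.+1 x -> ~~ small T x -> tenacity e M x = Some T.*2.+1.
Proof.
rewrite /small; case E: (tenacity e M x) => [t|] //.
have [a [c [_ _ tE oa oc]]] := tenacityE E.
by rewrite doubleS => ? ?; congr Some; lia.
Qed.

Lemma evenodd_pathP v p : evenodd_path e M v p ->
  exists f s, [/\ p = f :: s, unmatched M f, apath f s, last f s = v
    & lv (odd (size s)) v = Some (size s)].
Proof.
suff half o : level_path e M o v p ->
    exists f s, [/\ p = f :: s, unmatched M f, apath f s, last f s = v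
      & lv (odd (size s)) v = Some (size s)] by case/orP; apply: half.
case/level_pathP => f [s [pE uf ap ls lvs]]; exists f, s; split=> //.
by rewrite (lv_odd lvs).
Qed.

(** After the base a level path meets only vertices of its class, all of tenacity at most [2T + 1];
    the base, being fixed at stage [T + 1], has larger tenacity. *)
Lemma F_base T b v p : classes T.+1 b -> tenacity e M v = Some T.*2.+1 ->
  evenodd_path e M v p -> F e M p v = Some (b T.+1 v).
Proof.
move=> Hb tv /evenodd_pathP[f [s [-> uf ap ls lvs]]].
have smv : small T.+1 v by rewrite /small tv; lia.
have [s1 [s2 [sE l1 _ _ al]]] := class_decomp Hb smv uf ap ls lvs.
rewrite /F tv (eq_filter (elt_small T)) sE -cat_cons rev_cat filter_cat.
have -> : [seq x <- rev s2 | ~~ small T.+1 x] = [::].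
  apply/eqP; rewrite -size_eq0 size_filter -leqn0 leqNgt -has_count.
  apply/hasPn => w; rewrite mem_rev => /(allP al)/andP[_].
  by rewrite (cl_smallE Hb _ (leqnn _)) negbK.
rewrite lastI rev_rcons l1 /=.
suff -> : ~~ small T.+1 (b T.+1 v) by [].
by rewrite -(cl_smallE Hb _ (leqnn _)) (cl_idem Hb _ (leqnn _)) eqxx.
Qed.

Lemma B_base T b v : classes T.+1 b -> tenacity e M v = Some T.*2.+1 ->
  B e M v = [set Some (b T.+1 v)].
Proof.
move=> Hb tv; apply/setP => x; rewrite inE; apply/imsetP/eqP => [[p]|->].
  by rewrite inE => /(F_base Hb tv) ->.
have [a [_ [lva _ _ _ _]]] := tenacityE tv.
have [f [s [uf ap ls sz _]]] := lv_path lva.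
have szV : size (f :: s) <= #|V|.
  by have [_ un] := andP ap; rewrite -(card_uniqP un) max_card.
have eo : evenodd_path e M v (f :: s).
  by apply/orP; left; apply/level_pathP; exists f, s; rewrite sz.
exists (Bseq szV); first by rewrite inE.
by rewrite (F_base Hb tv eo).
Qed.

Lemma base_of_B v c : B e M v = [set Some c] -> base e M v = Some c.
Proof.
rewrite /base => BE; case: pickP => [d /eqP|/(_ c)]; last by rewrite BE eqxx.
by rewrite BE => /set1_inj[->].
Qed.

Lemma base_at T k b v : classes T b -> k < T -> tenacity e M v = Some k.*2.+1 ->
  base e M v = Some (b k.+1 v).
Proof.
by move=> Hb kT tv; apply/base_of_B/B_base => //; apply: classes_le Hb.
Qed.

Lemma not_small0 v : ~~ small 0 v.
Proof. by apply/negP => /smallP[a [c [_ _]]]. Qed.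

Lemma small_tenacity s v : small s v ->
  exists2 k, k < s & tenacity e M v = Some k.*2.+1.
Proof.
elim: s => [|s IH] sm; first by move: (not_small0 v); rewrite sm.
case: (boolP (small s v)) => [/IH[k ks tv]|nsm]; first by exists k => //; lia.
by exists s => //; apply: tenacity_small.
Qed.

(** A blossom is a class without its base. By [cl_mono] the base at one stage is obtained by
    applying that stage to the base at the previous one, so the recursion over [w] collects the
    nested classes. Tenacity 1 does not occur: it would make [v] unmatched, yet contracted. *)
Lemma blossom_recE T b k c : classes T b -> k < T -> outer e M c -> ~~ small k.+1 c ->
  blossom_rec e M k c = [set v | small k.+1 v && (b k.+1 v == c)].
Proof.
move=> Hb; elim: k c => [|k IH] c kT oc nsc.
  apply/setP => v; rewrite !inE; apply/esym/negP => /andP[sm _].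
  have [a [d [lva lvd lt oa od]]] := smallP sm.
  have a0 : a = 0 by lia.
  rewrite a0 in lva; have fv := cl_root Hb kT (even0_unmatched lva).
  by have := classes_strong Hb kT sm; rewrite fv eqxx.
have kT' : k < T by lia.
have fixed s v : s <= T -> ~~ small s v -> b s v = v.
  by move=> sT; rewrite -(cl_smallE Hb _ sT) negbK => /eqP.
have inS v : (v \in S_ e M c k.+1.*2.+1) = [&& small k.+2 v, ~~ small k.+1 v & b k.+2 v == c].
  rewrite inE; case: (boolP (small k.+2 v)) => sm /=; last first.
    by apply: contraNF sm => /andP[/eqP tv _]; rewrite /small tv; lia.
  case: (boolP (small k.+1 v)) => sm' /=.
    by apply: contraTF sm' => /andP[/eqP tv _]; rewrite /small tv; lia.
  have tv := tenacity_small sm sm'; rewrite tv eqxx /= (base_at Hb kT tv).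
  by apply/eqP/eqP => [[]|->].
have nsc' : ~~ small k.+1 c by apply: contra nsc; apply: small_le.
apply/setP => v; rewrite /= in_setU [v \in [set _ | _]]inE.
apply/idP/idP => [/orP[|/bigcupP[w /andP[win ow]]]|/andP[sm /eqP bv]].
- by rewrite inS => /and3P[-> _ ->].
- have [nsw bw] : ~~ small k.+1 w /\ b k.+2 w = c.
    move: win; rewrite in_setU1 => /predU1P[->|]; first by rewrite fixed.
    by rewrite inS => /and3P[_ -> /eqP].
  rewrite (IH w) // inE => /andP[sm /eqP bvw].
  rewrite (small_le (leqnSn _) sm) -(cl_mono Hb v (leqnSn k.+1) kT) bvw bw eqxx //.
case: (boolP (small k.+1 v)) => sm'; last by rewrite inS sm sm' bv eqxx.
apply/orP; right; apply/bigcupP; exists (b k.+1 v).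
  have bN := classes_strong Hb kT' sm'; rewrite (cl_outer Hb kT' bN) andbT.
  rewrite in_setU1 inS; case: eqVneq => //= bc.
  have bb : b k.+2 (b k.+1 v) = c by rewrite (cl_mono Hb v (leqnSn k.+1) kT).
  rewrite bb eqxx andbT -(cl_smallE Hb _ kT) bb eq_sym bc /=.
  by rewrite -(cl_smallE Hb _ kT') (cl_idem Hb _ kT') eqxx.
have bN := classes_strong Hb kT' sm'.
rewrite IH ?inE ?sm' ?eqxx //; first exact: (cl_outer Hb kT' bN).
by rewrite -(cl_smallE Hb _ kT') (cl_idem Hb _ kT') eqxx.
Qed.

Lemma reaches_fromP o c u p : reflect
  (exists s, [/\ p = c :: s, apath c s, last c s = u & odd (size s) = o])
  (reaches_from e M o c u p).
Proof.
apply: (iffP and4P) => [[alt /eqP <- ft hd]|[s [-> + <- <-]]].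
  case: p alt ft hd => //= z s alt /andP[/eqP zc /eqP <-] hd; subst z.
  by exists s; split=> //; rewrite -alternatingP alt.
by rewrite -alternatingP => /andP[alt hd]; rewrite /= !eqxx.
Qed.

Lemma level_path_fromP o c u p : level_path_from e M o c u p ->
  exists s, [/\ p = c :: s, apath c s, last c s = u, odd (size s) = o &
    forall s', apath c s' -> last c s' = u -> odd (size s') = o -> size s <= size s'].
Proof.
have un q : reaches_from e M o c u q -> uniq q.
  by case/reaches_fromP => s [-> /andP[]].
rewrite /level_path_from /min_len_path => /andP[/reaches_fromP[s [-> ap ls os]] /eqP sz].
exists s; split=> // s' ap' ls' os'; have := min_lenP un; rewrite -sz.
by case=> _ /(_ (c :: s')); apply; apply/reaches_fromP; exists s'.
Qed.

Lemma level_path_fromI o c u s : apath c s -> last c s = u -> odd (size s) = o ->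
  (forall s', apath c s' -> last c s' = u -> odd (size s') = o -> size s <= size s') ->
  level_path_from e M o c u (c :: s).
Proof.
move=> ap ls os le.
have rs : reaches_from e M o c u (c :: s) by apply/reaches_fromP; exists s.
have un q : reaches_from e M o c u q -> uniq q.
  by case/reaches_fromP => s' [-> /andP[]].
rewrite /level_path_from /min_len_path rs /=; have := min_lenP un.
case: min_len => [n [[p /reaches_fromP[s' [-> ap' ls' os']] <-] nmin]|/(_ (c :: s))/negP//].
by apply/eqP; congr Some; apply/eqP; rewrite eqn_leq le // (nmin _ rs).
Qed.

Section Structure.
Context (T : nat) (b : nat -> V -> V) (Hb : classes T.+1 b).
Context (u c : V) (smu : small T.+1 u) (bu : b T.+1 u = c).

(** The second part is shortest from [c] because [base_path] bounds every competitor, whether or not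
    it can be appended to the first part. *)
Lemma path_through_base o p : level_path e M o u p ->
  exists f s1 s2, [/\ p = (f :: s1) ++ s2, last f s1 = c,
    level_path e M false c (f :: s1), level_path_from e M o c u (c :: s2) &
    uniq (f :: s1 ++ s2) /\ all (fun w => (b T.+1 w == c) && (b T.+1 w != w)) s2].
Proof.
case/level_pathP => f [s [-> uf ap ls lvs]]; have os := lv_odd lvs.
rewrite -os in lvs; have := class_decomp Hb smu uf ap ls lvs; rewrite bu.
case=> s1 [s2 [sE l1 o1 [lvc Yc] al]]; exists f, s1, s2; rewrite sE in ap ls lvs os.
have [alt un] := andP ap; split=> //; first by rewrite sE.
  by apply/level_pathP; exists f, s1; split=> //; apply: apath_cat ap.
move: alt un; rewrite alts_cat l1 (negPf o1) -cat_cons cat_uniq.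
case/andP => alt1 alt2 /and3P[un1 /hasPn dis un2].
have os2 : odd (size s2) = o by rewrite -os size_cat oddD (negPf o1).
apply: (level_path_fromI _ _ os2).
- rewrite /apath alt2 /= un2 andbT; apply/negP => cs2.
  by have := dis _ cs2; rewrite -l1 mem_last.
- by move: ls; rewrite last_cat l1.
move=> s'; rewrite -bu => ap' ls' os'.
have lvo : lv (odd (size s')) u = Some (size (s1 ++ s2)).
  by rewrite os' -os lvs.
rewrite -bu in lvc; have [] := base_path Hb smu ap' ls' lvc lvo.
by rewrite size_cat; clear; lia.
Qed.

(** A minimum path from the base is no longer than the second part of a level path to [u], so
    [base_path] holds with equality and yields tightness. *)
Lemma path_from_base o r : level_path_from e M o c u r ->
  exists2 s, r = c :: s & [/\ apath c s, last c s = u, tight T.+1 b c s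
    & all (fun w => (b T.+1 w == c) && (b T.+1 w != w)) s].
Proof.
case/level_path_fromP => s [-> ap ls os smin]; exists s => //.
have [n lvn] : exists n : nat, lv o u = Some n.
  by have [i [j [lvi lvj _ _ _]]] := smallP smu; case: (o); [exists j|exists i].
have [f [q [uf apq lq sq _]]] := lv_path lvn.
have /path_through_base[f' [s1 [s2 [pE l1 lp1 lp2 _]]]] : level_path e M o u (f :: q).
  by apply/level_pathP; exists f, q; rewrite sq.
case/level_pathP: lp1 => f'' [s1' [[_ s1E] _ _ _ lvc]].
case/level_path_fromP: lp2 => s2' [[s2E] ap2 ls2 os2 _].
rewrite -{}s1E in lvc; rewrite -{}s2E in ap2 ls2 os2.
have le : size s <= size s2 by apply: smin.
have nE : n = size s1 + size s2.
  by move: (congr1 size pE); rewrite size_cat /= sq => -[].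
rewrite -bu in lvc ap ls *.
have := base_path Hb smu ap ls lvc; rewrite os => /(_ _ lvn)[_].
by case; [rewrite nE addnC leq_add2l|].
Qed.

End Structure.

(** Stage [T + 1] contributes to [common], as both ends of the edge are in the class; the tight
    constraint, now with right-hand side [2T + 2], gives [a + c <= 2T]. *)
Lemma tight_edge_tenacity T b c s x y : classes T.+1 b -> outer e M c ->
  b T.+1 c = c -> apath c s -> tight T.+1 b c s ->
  all (fun w => (b T.+1 w == c) && (b T.+1 w != w)) s ->
  (x, y) \in path_edges (c :: s) -> ele (edge_tenacity e M x y) (Some T.*2.+1).
Proof.
move=> Hb oc bc /andP[alt _] tgt al /path_edgesP[s1 [s2 [sE l1]]].
have := al; rewrite sE all_cat /= => /and3P[al1 /andP[/eqP by1 byN] _].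
have xt : b T.+1 x = c /\ otype (b T.+1) x.
  case: (lastP s1) al1 l1 => [_ <- //|s1' z]; first by rewrite /otype oc.
  rewrite all_rcons last_rcons => /andP[/andP[/eqP bz bzN] _] <-.
  by rewrite /otype bzN orbT.
have yt : otype (b T.+1) y by rewrite /otype byN orbT.
move: alt; rewrite sE alts_cat l1 /= => /and4P[_ exy /eqP Mxy _].
case: (boolP (odd (size s1))) Mxy => os Mxy.
  rewrite edge_tenacity_matched // (tenacity_matched Mxy) ele_small.
  by rewrite -(cl_smallE Hb _ (leqnn _)).
have [_ st] := tgt s1 (y :: s2) sE.
have [] := st _ _ erefl os; rewrite l1 => {}st _.
have [] := tight_edge_cases Hb exy Mxy st.
- move=> [a [d [_ _ lva lvd sz]]]; rewrite (edge_tenacity_unmatched Mxy lva lvd) /=.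
  have : 0 < common T.+1 b x y; last by lia_nat.
  by rewrite /common big_ord_recr /= xt.1 by1 eqxx addn1.
- by move=> [d [/negP[]]]; case: xt.
- by move=> [d [/negP[]]].
Qed.

Lemma below_l_m_le n m : n <= m -> below_l_m m -> below_l_m n.
Proof.
by rewrite /below_l_m /elt; case: (l_m e M) => [L|] //=; rewrite -!ltnNge; lia.
Qed.

Lemma classes_eligible T : below_l_m T.*2.+1 -> exists b, classes T.+1 b.
Proof.
by move=> lt; apply: classes_exist => s sT; apply: below_l_m_le lt; rewrite ltnS leq_double.
Qed.

Lemma eligibleP t : eligible e M t -> exists2 T, t = T.*2.+1 & below_l_m t.
Proof.
case/and3P => ot _ lt; exists t./2 => //.
by rewrite -[LHS]odd_double_half ot.
Qed.

Lemma laminar T b t1 t2 X1 X2 : classes T b -> t1 <= t2 -> t2 < T.*2 ->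
  is_blossom e M t1 X1 -> is_blossom e M t2 X2 -> [disjoint X1 & X2] \/ X1 \subset X2.
Proof.
move=> Hb le12 lt2 [c1 [o1 oc1 lt1 ->]] [c2 [o2 oc2 lt2' ->]].
have odE t : odd t -> t = t./2.*2.+1 by move=> ot; rewrite -[LHS]odd_double_half ot.
move: lt1 lt2'; rewrite (odE _ o1) (odE _ o2) !elt_small => ns1 ns2.
have k12 : t1./2 <= t2./2 by apply: half_leq.
have k2T : t2./2 < T by move: lt2; rewrite {1}(odE _ o2); lia.
have k1T : t1./2 < T by apply: leq_ltn_trans k2T.
rewrite /blossom -(odE _ o1) -(odE _ o2) (blossom_recE Hb k1T oc1 ns1) (blossom_recE Hb k2T oc2 ns2).
have bE v w : b (t1./2).+1 v = b (t1./2).+1 w -> b (t2./2).+1 v = b (t2./2).+1 w.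
  move=> bvw; have k12' : (t1./2).+1 <= (t2./2).+1 by [].
  by rewrite -(cl_mono Hb v k12' k2T) bvw (cl_mono Hb w k12' k2T).
case: (boolP [disjoint _ & _]) => [?|nd]; [by left|right; move: nd].
rewrite disjoint_subset => /subsetPn[v]; rewrite !inE negbK.
move=> /andP[_ /eqP b1] /andP[_ /eqP b2]; apply/subsetP => w.
rewrite !inE => /andP[sm /eqP bw]; rewrite (small_le _ sm) //.
by rewrite -b2; apply/eqP/bE; rewrite bw b1.
Qed.

End Matching.

Theorem theorem6p7 (V : finType) (e M : rel V)
    (He : graph e) (HM : matching e M) :
  [/\
    (* (1) *)
    (forall v t, eligible e M t -> tenacity e M v = Some t ->
       exists b, B e M v = [set Some b])
    /\ (forall v t, eligible e M t -> tenacity e M v = Some t ->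
       exists b, base e M v = Some b)
    /\ (forall t, eligible e M t -> blossoms_defined e M t),
    forall (t : nat) (v : V), eligible e M t -> tenacity e M v = Some t ->
    [/\
      (* (2) *)
      forall p, maxlevel_path e M v p -> unique_bridge e M (Some t) p,
      (* (3) *)
      forall t1 t2 (X1 X2 : {set V}), t1 <= t -> t2 <= t ->
        is_blossom e M t1 X1 -> is_blossom e M t2 X2 ->
        [\/ [disjoint X1 & X2], X1 \subset X2 | X2 \subset X1],
      (* (4) *)
      forall b u, base e M v = Some b -> u \in blossom e M b t ->
        [/\ forall p, evenlevel_path e M u p ->
              exists q r, [/\ evenlevel_path e M b q,
                evenlevel_path_from e M b u r & p = concat_path q r],
            forall p, oddlevel_path e M u p ->
              exists q r, [/\ evenlevel_path e M b q,
                oddlevel_path_from e M b u r & p = concat_path q r]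
          & forall r, evenlevel_path_from e M b u r \/
                      oddlevel_path_from e M b u r ->
              {subset r <= b |: blossom e M b t} /\
              forall x y, (x, y) \in path_edges r ->
                ele (edge_tenacity e M x y) (Some t)]
      (* (5) *)
    & forall b p u, base e M v = Some b -> evenodd_path e M v p ->
        u \in subpath_oc p b ->
        exists c, base e M u = Some c /\ c \in subpath_cc p b]
  & forall v p, tenacity e M v = l_m e M -> maxlevel_path e M v p ->
      unique_bridge e M (l_m e M) p].
Proof.
have allB v t : eligible e M t -> tenacity e M v = Some t -> exists b, B e M v = [set Some b].
  move=> /eligibleP[T -> lt] tv; have [b Hb] := classes_eligible He HM lt.
  by exists (b T.+1 v); apply: (B_base He HM Hb).
split; [split; [exact: allB|split]| |].
- by move=> v t el /(allB _ _ el)[b BE]; exists b; apply: base_of_B.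
- move=> t /eligibleP[T -> lt] v; have [b Hb] := classes_eligible He HM lt.
  rewrite ele_small => /(small_tenacity)[k kT tv].
  by exists (b k.+1 v); apply: (base_at He HM Hb kT tv).
- move=> t v /eligibleP[T -> lt] tv; have [b Hb] := classes_eligible He HM lt.
  have smv : small e M T.+1 v by rewrite /small tv; lia.
  have bvN : b T.+1 v != v by rewrite (cl_smallE He HM Hb _ (leqnn _)).
  have baseE c : base e M v = Some c -> b T.+1 v = c.
    by rewrite (base_at He HM Hb (ltnSn T) tv) => -[].
  split.
  + move=> p mp; by apply: (unique_bridge_max He HM (classes_le (leqnSn T) Hb) tv mp).
  + move=> t1 t2 X1 X2 le1 le2 b1 b2; case: (leqP t1 t2) => [le12|/ltnW le21].
      have lt2 : t2 < T.+1.*2 by lia.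
      by case: (laminar He HM Hb le12 lt2 b1 b2) => ?; [constructor 1|constructor 2].
    have lt1 : t1 < T.+1.*2 by lia.
    case: (laminar He HM Hb le21 lt1 b2 b1) => ?; [constructor 1|by constructor 3].
    by rewrite disjoint_sym.
  + move=> c u /baseE bv; have oc : outer e M c by rewrite -bv; apply: (cl_outer Hb).
    have bc : b T.+1 c = c by rewrite -bv (cl_idem Hb _ (leqnn _)).
    have nsc : ~~ small e M T.+1 c by rewrite -(cl_smallE He HM Hb _ (leqnn _)) bc eqxx.
    have blE : blossom e M c T.*2.+1 = [set w | small e M T.+1 w && (b T.+1 w == c)].
      by rewrite /blossom /= uphalf_double (blossom_recE He HM Hb (ltnSn T)).
    rewrite blE inE => /andP[smu /eqP bu].
    have dec o p : level_path e M o u p -> exists q r,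
        [/\ evenlevel_path e M c q, level_path_from e M o c u r & p = concat_path q r].
      case/(path_through_base He HM Hb smu bu) => f [s1 [s2 [-> _ lp1 lp2 _]]].
      by exists (f :: s1), (c :: s2).
    split; [exact: dec|exact: dec|move=> r lr].
    have [o {}lr] : exists o, level_path_from e M o c u r.
      by case: lr; [exists false|exists true].
    have [s -> [ap ls tgt al]] := path_from_base He HM Hb smu bu lr; split.
      move=> w; rewrite inE in_setU1 => /predU1P[->|/(allP al)/andP[bw bwN]]; first by rewrite eqxx.
      by rewrite inE bw andbT -(cl_smallE He HM Hb _ (leqnn _)) bwN orbT.
    by move=> x y; apply: (tight_edge_tenacity He HM Hb oc bc ap tgt al).
  + move=> c p u /baseE bv eo.
    have [o lp] : exists o, level_path e M o v p by case/orP: eo; [exists false|exists true].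
    have [f [s1 [s2 [-> l1 _ lp2 [un al]]]]] := path_through_base He HM Hb smv bv lp.
    have [s [sE] [ap ls tgt _]] := path_from_base He HM Hb smv bv lp2; subst s.
    have ccE : subpath_cc ((f :: s1) ++ s2) c = c :: s2.
      have fE : f :: s1 = rcons (belast f s1) c by rewrite -l1 -lastI.
      move: un; rewrite -cat_cons /subpath_cc fE cat_rcons => un.
      have cN : c \notin belast f s1.
        by move: un; rewrite cat_uniq /= => /and3P[_ /norP[]].
      by rewrite index_cat (negPf cN) /= eqxx addn0 drop_size_cat.
    rewrite /subpath_oc ccE /= => us2; have /andP[/eqP bu buN] := allP al u us2.
    have smu := cl_small Hb (leqnn _) buN; have [k kT tu] := small_tenacity smu.
    exists (b k.+1 u); split; first exact: (base_at He HM Hb kT tu).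
    have [alt unc] := andP ap.
    (* At the stage of the tenacity of [u], the base of [v] is [c] if the tenacities agree and [v]
       itself otherwise; both are on the path. *)
    apply: (tight_visited Hb kT alt unc tgt); first by rewrite inE us2 orbT.
    rewrite ls; case: (boolP (small e M k.+1 v)) => smk.
      have -> : k = T by move: smk kT; rewrite /small tv; clear; lia.
      by rewrite bv mem_head.
    suff -> : b k.+1 v = v by rewrite -ls mem_last.
    by apply/eqP; move: smk; rewrite -(cl_smallE He HM Hb _ kT) negbK.
move=> v p; case tl: (l_m e M) => [L|] tv mp; last first.
  (* Infinite tenacity makes [maxlevel] infinite, so no path attains it. *)
  move: mp tv => /andP[_]; rewrite /maxlevel /tenacity.
  by case: evenlevel => [a|]; case: oddlevel.
have [a [d [_ _ LE oa od]]] := tenacityE tv.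
have LT : L = L./2.*2.+1 by rewrite -[LHS]odd_double_half LE oddD oa od.
(* With [l_m = 2T + 1], reaching stage [T] needs only [2s + 1 < l_m] for [s < T]. *)
have [b Hb] : exists b, classes e M L./2 b.
  apply: (classes_exist He HM) => s sT; rewrite /below_l_m tl /elt /= -ltnNge; lia.
by rewrite LT in tv *; apply: (unique_bridge_max He HM Hb tv mp).
Qed.
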